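(* Let $D>0$, $t>0$ and $x,y\in\mathbb{R}$. There exists a unique regular Borel measure $\mathcal{W}^{x,y;t}$ on $\Omega_{x,y;t}$ such that for every cylindrical function $F:\Omega_{x,y;t}\to\mathbb{R}$, written as $F(\gamma)=\tilde F(\gamma(t_1),\ldots,\gamma(t_N))$ with $0<t_1<\cdots<t_N<t$ and $\tilde F:\hat{\mathbb{R}}^N\to\mathbb{R}$, $$\int_{\Omega_{x,y;t}}F(\gamma)\,d\mathcal{W}^{x,y;t}(\gamma)=\int_{\mathbb{R}}\cdots\int_{\mathbb{R}}\tilde F(x_1,\ldots,x_N)\prod_{i=1}^{N+1}\varphi(x_i-x_{i-1},t_i-t_{i-1})\,dx_1\cdots dx_N,$$ where $t_0=0$, $t_{N+1}=t$, $x_0=x$ and $x_{N+1}=y$.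
   Context: For $z\in\mathbb{R}$ and $s>0$, $\varphi(z,s)=\frac{1}{\sqrt{4\pi Ds}}\exp\!\left(-\frac{|z|^2}{4Ds}\right)$ is the Gaussian (heat) kernel. $\hat{\mathbb{R}}=\mathbb{R}\cup\{\infty\}$ is the one-point compactification of $\mathbb{R}$. $\Omega_{x,y;t}$ is the set of all functions $\gamma:[0,t]\to\hat{\mathbb{R}}$ (not necessarily continuous) with $\gamma(0)=x$ and $\gamma(t)=y$, with the product topology (topology of pointwise convergence), in which it is a compact Hausdorff space; it carries its Borel $\sigma$-algebra. ''Regular Borel measure'' means a (nonnegative) finite regular measure on this Borel $\sigma$-algebra. A function $F:\Omega_{x,y;t}\to\mathbb{R}$ is cylindrical if it is continuous and there are finitely many times $t_1\le\cdots\le t_j$ in $[0,t]$ and a function $\tilde F:\hat{\mathbb{R}}^j\to\mathbb{R}$ with $F(\gamma)=\tilde F(\gamma(t_1),\ldots,\gamma(t_j))$ for all $\gamma\in\Omega_{x,y;t}$. Since $\gamma(0)=x$ and $\gamma(t)=y$ are fixed, every cylindrical function can be written using finitely many (at least one) distinct times in the open interval $(0,t)$. The measure $\mathcal{W}^{x,y;t}$ is called the Wiener measure with fixed endpoints $x$ and $y$ at time $t$. *)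

(* Defs.v *)
From HB Require Import structures.
From mathcomp Require Import all_boot all_order all_algebra.
From mathcomp Require Import all_classical all_reals all_analysis.

Set Implicit Arguments.
Unset Strict Implicit.
Unset Printing Implicit Defensive.

Import Order.TTheory GRing.Theory Num.Theory.
Import numFieldNormedType.Exports.

Local Open Scope classical_set_scope.
Local Open Scope ring_scope.

Definition heat_kernel (R : realType) (D z s : R) : R :=
  (Num.sqrt (4 * pi * D * s))^-1 * expR (- (`|z| ^+ 2 / (4 * D * s))).

Notation Rhat R := (one_point_compactification R).

(* The product space of all functions [0, t] -> Rhat R; `[0, t] is used as the
   subtype of its elements. *)
Notation all_paths t := {ptws (`[0%R, t]%classic) -> Rhat _}.

Definition fixed_endpoints (R : realType) (t x y : R) : set (all_paths t) :=
  [set g | (forall s, set_val s = 0 -> g s = Some x) /\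
           (forall s, set_val s = t -> g s = Some y)].
Arguments fixed_endpoints {R} t x y.

(* MathComp-Analysis measurable types are pointed; the proof of 0 < t is a
   parameter of the type because it is what makes the space inhabited. *)
Definition path_space (R : realType) (t : R) (t0 : 0 < t) (x y : R) : Type :=
  set_type (fixed_endpoints t x y).

Lemma path_space_inhabited (R : realType) (t : R) (t0 : 0 < t) (x y : R) :
  (fun s => if set_val s == 0 then Some x else Some y)
    \in fixed_endpoints t x y.
Proof.
apply/mem_set; split=> s /= ->; first by rewrite eqxx.
by rewrite gt_eqF.
Qed.

HB.instance Definition _ (R : realType) (t : R) (t0 : 0 < t) (x y : R) :=
  Topological.on (path_space t0 x y).

HB.instance Definition _ (R : realType) (t : R) (t0 : 0 < t) (x y : R) :=
  isPointed.Build (path_space t0 x y)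
    (exist (fun g => g \in fixed_endpoints t x y) _ (path_space_inhabited t0 x y)).

Definition path_eval (R : realType) (t : R) (t0 : 0 < t) (x y : R)
    (g : path_space t0 x y) (s : `[0%R, t]%classic) : Rhat R :=
  set_val g s.

Definition cylindrical (R : realType) (t : R) (t0 : 0 < t) (x y : R)
    (F : path_space t0 x y -> R) : Prop :=
  continuous F /\
  exists (j : nat) (ts : j.-tuple `[0%R, t]%classic)
         (Ft : j.-tuple (Rhat R) -> R),
    sorted <=%R (map set_val ts) /\
    forall g, F g = Ft (map_tuple (path_eval g) ts).

Notation borel T := (g_sigma_algebraType (@open T)).

Definition regular_measure (R : realType) (T : ptopologicalType)
    (mu : {measure set (borel T) -> \bar R}) : Prop :=
  forall A : set (borel T), measurable A ->
    mu A = ereal_inf [set mu U | U in [set U : set T | open U /\ A `<=` U]] /\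
    mu A = ereal_sup [set mu K | K in [set K : set T | compact K /\ K `<=` A]].

(* Iterated Lebesgue integral; the first coordinate is integrated innermost. *)
Fixpoint iterated_integral (R : realType) (n : nat) :
    (n.-tuple R -> \bar R) -> \bar R :=
  match n with
  | 0 => fun f => f [tuple]
  | m.+1 => fun f => (\int[lebesgue_measure]_z
      iterated_integral (fun s : m.-tuple R => f [tuple of rcons s z]))%E
  end.

(* With s = (t_0, ..., t_N+1) and z = (x_0, ..., x_N+1) as sequences. *)
Definition kernel_product (R : realType) (D : R) (N : nat) (s z : seq R) : R :=
  \prod_(1 <= i < N.+2)
    heat_kernel D (nth 0 z i - nth 0 z i.-1) (nth 0 s i - nth 0 s i.-1).

Definition cylindrical_formula (R : realType) (D t : R) (t0 : 0 < t) (x y : R)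
    (W : {measure set (borel (path_space t0 x y)) -> \bar R}) : Prop :=
  forall F : path_space t0 x y -> R, cylindrical F ->
  forall (N : nat) (ts : N.-tuple `[0%R, t]%classic)
         (Ft : N.-tuple (Rhat R) -> R),
    (0 < N)%N ->
    path <%R 0 (rcons (map set_val ts) t) ->
    (forall g, F g = Ft (map_tuple (path_eval g) ts)) ->
    (\int[W]_g (F g)%:E)%E =
    iterated_integral (fun xs : N.-tuple R =>
      (Ft (map_tuple (Some : R -> Rhat R) xs) *
       kernel_product D N (0 :: rcons (map set_val ts) t)
                          (x :: rcons xs y))%:E).

(* Main.v *)
Require Import Defs.
From HB Require Import structures.
From mathcomp Require Import all_boot all_order all_algebra.
From mathcomp Require Import all_classical all_reals all_analysis.
From mathcomp Require Import measurable_realfun finmap ring lra.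

(* Write a cylindrical function through values at finitely many interior times
   and integrate it against the product of heat kernels. Chapman-Kolmogorov shows
   that the result does not depend on the chosen times, so this defines a positive
   additive functional on the cone of nonnegative cylindrical functions on the
   path space, which is compact by Tychonoff. Bump functions from this cone
   separate points from closed sets, so the Riesz-Markov construction applies to
   the cone itself: the content of an open set is the supremum of the functional
   over test functions below its indicator, the induced outer measure is regular,
   and open sets are Caratheodory measurable. Two regular measures with the same
   integrals of test functions agree on closed sets by bump functions, hence
   everywhere by regularity. *)

Set Implicit Arguments.
Unset Strict Implicit.
Unset Printing Implicit Defensive.

Import Order.TTheory GRing.Theory Num.Theory.
Import numFieldNormedType.Exports.

Local Open Scope classical_set_scope.
Local Open Scope ring_scope.

(** * The Riesz-Markov theorem for a cone of test functions *)

Lemma continuous_bounded_compact (R : realType) (T : topologicalType)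
    (F : T -> R) :
  compact [set: T] -> continuous F -> exists2 M : R, 0 < M & forall p, `|F p| <= M.
Proof.
move=> cptT cF; have /compact_bounded : compact (F @` setT).
  by apply: continuous_compact cptT; exact: continuous_subspaceT.
by move=> /pinfty_ex_gt0[M M0 FM]; exists M => // p; rewrite FM //; exists p.
Qed.

Definition tsub (R : realType) (T : Type) (F G : T -> R) (p : T) : R :=
  Num.max (F p - G p) 0.

(* L is a cone of nonnegative test functions, not all of C(T); closure under
   truncated difference makes it closed under min and max. *)
Record positive_functional (R : realType) (T : topologicalType)
    (L : set (T -> R)) (I : (T -> R) -> R) : Prop := PositiveFunctional {
  pf_cont : forall F, L F -> continuous F;
  pf_ge0 : forall F, L F -> forall p, 0 <= F p;
  pf_one : L (fun=> 1);
  pf_add : forall F G, L F -> L G -> L (fun p => F p + G p);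
  pf_scale : forall (c : R) F, 0 <= c -> L F -> L (fun p => c * F p);
  pf_tsub : forall F G, L F -> L G -> L (tsub F G);
  pf_sep : forall (U : set T) p, open U -> U p ->
    exists F, [/\ L F, 0 < F p & forall q, ~ U q -> F q = 0];
  pf_le : forall F G, L F -> L G -> (forall p, F p <= G p) -> I F <= I G;
  pf_intD : forall F G, L F -> L G -> I (fun p => F p + G p) = I F + I G;
  pf_intZ : forall (c : R) F, 0 <= c -> L F -> I (fun p => c * F p) = c * I F
}.

Section RieszMarkov.
Context {R : realType} {T : ptopologicalType}.
Variables (L : set (T -> R)) (I : (T -> R) -> R).
Hypothesis cptT : compact [set: T].
Hypothesis LI : positive_functional L I.

Let L_zero : L (fun=> 0).
Proof.
have := pf_scale LI (lexx 0) (pf_one LI).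
by congr L; apply/funext => p; rewrite mul0r.
Qed.

Let I_zero : I (fun=> 0) = 0.
Proof.
rewrite -[RHS](mul0r (I (fun=> 1))) -(pf_intZ LI (lexx 0) (pf_one LI)).
by congr I; apply/funext => p; rewrite mul0r.
Qed.

Let L_cst c : 0 <= c -> L (fun=> c).
Proof.
move=> c0; have := pf_scale LI c0 (pf_one LI).
by congr L; apply/funext => p; rewrite mulr1.
Qed.

Let I_cst c : 0 <= c -> I (fun=> c) = c * I (fun=> 1).
Proof.
move=> c0; rewrite -(pf_intZ LI c0 (pf_one LI)).
by congr I; apply/funext => p; rewrite mulr1.
Qed.

Let I_ge0 F : L F -> 0 <= I F.
Proof.
by move=> LF; rewrite -I_zero; apply: (pf_le LI) => // p; exact: (pf_ge0 LI).
Qed.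

(** This is the identity [min F G = F - (F - G)^+]; the outer truncation changes nothing because [F]
    and [G] are nonnegative. *)
Let L_min F G : L F -> L G -> L (fun p => Num.min (F p) (G p)).
Proof.
move=> LF LG; have := pf_tsub LI LF (pf_tsub LI LF LG).
congr L; apply/funext => p; rewrite /tsub.
have := pf_ge0 LI LF p; have := pf_ge0 LI LG p.
by rewrite /Num.max /Num.min; do !case: ifPn; lra.
Qed.

Let L_sum (J : Type) (s : seq J) (P : pred J) (F : J -> T -> R) :
  (forall j, P j -> L (F j)) -> L (fun p => \sum_(j <- s | P j) F j p).
Proof.
move=> LF; elim: s => [|j s IH].
  by have := L_zero; congr L; apply/funext => p; rewrite big_nil.
have [Pj|nPj] := boolP (P j).
  have := pf_add LI (LF _ Pj) IH.
  by congr L; apply/funext => p; rewrite big_cons Pj.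
by move: IH; congr L; apply/funext => p; rewrite big_cons (negbTE nPj).
Qed.

Let I_sum (J : Type) (s : seq J) (F : J -> T -> R) :
  (forall j, L (F j)) ->
  I (fun p => \sum_(j <- s) F j p) = \sum_(j <- s) I (F j).
Proof.
move=> LF; elim: s => [|j s IH].
  by rewrite big_nil -I_zero; congr I; apply/funext => p; rewrite big_nil.
rewrite big_cons -IH -(pf_intD LI) //; last exact: L_sum.
by congr I; apply/funext => p; rewrite big_cons.
Qed.

(** * Level sets of test functions and bump functions *)

Let openF_gt F (c : R) : L F -> open [set p | c < F p].
Proof.
move=> LF; apply: (@open_comp _ _ F [set z | c < z]) => [p _|].
  exact: (pf_cont LI LF).
exact: open_gt.
Qed.

Let closedF_ge F (c : R) : L F -> closed [set p | c <= F p].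
Proof.
move=> /(pf_cont LI) cF.
exact: (closed_comp (fun p _ => cF p) (@closed_ge R c)).
Qed.

Let compact_ge F (c : R) : L F -> compact [set p | c <= F p].
Proof. by move=> LF; apply: subclosed_compact cptT _ => //; exact: closedF_ge. Qed.

(** A substitute for a partition of unity. Each point of [K] gets a test function exceeding 1 there
    and vanishing off a single [U n]; finitely many suffice by compactness, and those assigned to
    the same index are summed and cut at 1. *)
Lemma finite_bumps (K : set T) (U : nat -> set T) :
  compact K -> (forall n, open (U n)) -> K `<=` \bigcup_n U n ->
  exists (G : nat -> T -> R) N,
    [/\ forall n, L (G n), forall n p, G n p <= 1,
      forall n p, ~ U n p -> G n p = 0 &
      forall p, K p -> 1 <= \sum_(n < N) G n p].
Proof.
move=> cK oU KU.
have /choice[n_ nU] p : exists n, K p -> U n p.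
  by have [/KU[n _ Up]|nK] := pselect (K p); [exists n|exists 0%N].
have /choice[F_ FP] p : exists F, K p ->
    [/\ L F, 1 < F p & forall q, ~ U (n_ p) q -> F q = 0].
  have [Kp|nK] := pselect (K p); last by exists (fun=> 0).
  have [F [LF Fp F0]] := pf_sep LI (oU _) (nU _ Kp).
  (* The factor gives the value 2 at [p], so [p] lies in the open set where the function exceeds
     1. *)
  exists (fun q => (2 / F p) * F q) => _; split.
  - by apply: (pf_scale LI) => //; rewrite divr_ge0 // ltW.
  - by rewrite divfK ?gt_eqF // ltr1n.
  - by move=> q Uq; rewrite (F0 q Uq) mulr0.
move: (cK); rewrite compact_cover => /(_ T K (fun p => [set q | 1 < F_ p q])).
case=> [p /FP[LF _ _]|p Kp|D' D'K KD']; first exact: openF_gt.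
  by exists p => //=; have [] := FP _ Kp.
have D'P p : p \in D' -> [/\ L (F_ p), 1 < F_ p p &
    forall q, ~ U (n_ p) q -> F_ p q = 0].
  by move=> /D'K/set_mem/FP.
pose H n q := \sum_(p <- D' | (p \in D') && (n_ p == n)) F_ p q.
have LH n : L (H n) by apply: L_sum => p /andP[/D'P[]].
(* The bound [N] is one more than the largest index assigned to a point of the finite subcover. *)
exists (fun n q => Num.min (H n q) 1), (\max_(p <- D') n_ p).+1; split.
- by move=> n; apply: L_min => //; exact: pf_one LI.
- by move=> n p; rewrite ge_min lexx orbT.
- move=> n q nUq; rewrite /H big1 ?minEle ?ler01// => p /andP[/D'P[_ _ F0] /eqP pn].
  by apply: F0; rewrite pn.
- move=> q /KD'[p /= pD' Fpq].
  have np : (n_ p < (\max_(p <- D') n_ p).+1)%N by rewrite ltnS leq_bigmax_seq.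
  rewrite (bigD1 (Ordinal np)) //= ler_wpDr //.
    by apply: sumr_ge0 => i _; rewrite le_min ler01 (pf_ge0 LI).
  rewrite le_min lexx andbT /H (big_rem p) //= pD' eqxx /=.
  apply: ler_wpDr; last exact: ltW.
  apply: sumr_ge0 => i /andP[/D'P[LFi _ _] _].
  exact: (pf_ge0 LI LFi).
Qed.

(** The constant cover by [U] gives bumps whose sum is at least 1 on [K]; cutting this sum at 1
    makes it equal to 1 there. *)
Lemma bump (K U : set T) : compact K -> open U -> K `<=` U ->
  exists G, [/\ L G, forall p, G p <= 1, forall p, ~ U p -> G p = 0 &
    forall p, K p -> G p = 1].
Proof.
move=> cK oU KU.
have [|G [N [LG _ G0 G1]]] := finite_bumps cK (fun=> oU).
  by move=> p /KU Up; exists 0%N.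
have LS : L (fun p => \sum_(n < N) G n p) by exact: L_sum.
exists (fun p => Num.min (\sum_(n < N) G n p) 1); split.
- by apply: L_min => //; exact: pf_one LI.
- by move=> p; rewrite ge_min lexx orbT.
- by move=> p nU; rewrite big1 ?minEle ?ler01// => n _; rewrite G0.
- by move=> p /G1 G1p; apply/min_idPr.
Qed.

(** The functions only have to vanish off [U]; no compact support inside [U] is demanded. This keeps
    the condition pointwise, and a cut at small height recovers a compact set when one is needed. *)
Definition riesz_below (U : set T) : set (T -> R) :=
  [set F | [/\ L F, forall p, F p <= 1 & forall p, ~ U p -> F p = 0]].

Definition riesz_content (U : set T) : \bar R :=
  ereal_sup [set (I F)%:E | F in riesz_below U].

Let below0 U : riesz_below U (fun=> 0).
Proof. by split. Qed.

Let lam_ge0 U : (0 <= riesz_content U)%E.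
Proof.
apply: ereal_sup_ubound; exists (fun=> 0); first exact: below0.
by rewrite I_zero.
Qed.

Let lam_le1 U : (riesz_content U <= (I (fun=> 1))%:E)%E.
Proof.
apply: ge_ereal_sup => _ [F [LF F1 _] <-]; rewrite lee_fin.
by apply: (pf_le LI) => //; exact: pf_one LI.
Qed.

Let lam_fin U : riesz_content U \is a fin_num.
Proof. by rewrite ge0_fin_numE // (le_lt_trans (lam_le1 U)) ?ltry. Qed.

Let I_le_lam F U : riesz_below U F -> ((I F)%:E <= riesz_content U)%E.
Proof. by move=> FU; apply: ereal_sup_ubound; exists F. Qed.

Let le_lam U V : U `<=` V -> (riesz_content U <= riesz_content V)%E.
Proof.
move=> UV; apply: ge_ereal_sup => _ [F [LF F1 F0] <-]; apply: I_le_lam.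
by split => // p Vp; apply: F0 => /UV.
Qed.

(* Cutting F at height e makes its support a subset of the compact {e <= F}. *)
Let I_tsub F (e : R) : 0 <= e -> L F ->
  I F <= I (tsub F (fun=> e)) + e * I (fun=> 1).
Proof.
move=> e0 LF; have LFe := pf_tsub LI LF (L_cst e0).
rewrite -I_cst // -(pf_intD LI) //; last exact: L_cst.
apply: (pf_le LI) => //; first by apply: (pf_add LI) => //; exact: L_cst.
by move=> p; rewrite -lerBlDr /tsub le_max lexx.
Qed.

Let small (e : R) : 0 < e -> exists2 d, 0 < d & d * I (fun=> 1) <= e.
Proof.
move=> e0; have c0 := I_ge0 (pf_one LI).
(* Adding 1 keeps the divisor positive even when [I (fun=> 1)] is zero. *)
have d0 : 0 < I (fun=> 1) + 1 by rewrite ltr_wpDl.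
exists (e / (I (fun=> 1) + 1)); first by rewrite divr_gt0.
by rewrite mulrAC ler_pdivrMr // ler_wpM2l ?(ltW e0) // lerDl.
Qed.

(** For [F] below the union, the compact set where [d <= F] is covered by the [U n], so finitely
    many bumps [G n], each below [U n], add up to a function dominating [(F - d)^+]. The cut costs
    at most [d * I (fun=> 1) <= e]. *)
Let lam_bigcup (U : nat -> set T) : (forall n, open (U n)) ->
  (riesz_content (\bigcup_n U n) <= \sum_(n <oo) riesz_content (U n))%E.
Proof.
move=> oU; apply: ge_ereal_sup => _ [F [LF F1 F0] <-].
apply/lee_addgt0Pr => e /small[d d0 de].
have LFd := pf_tsub LI LF (L_cst (ltW d0)).
have [|G [N [LG G1 G0 GK]]] := finite_bumps (@compact_ge F d LF) oU.
  move=> p /= dF; apply: contrapT => /F0 Fp; move: dF.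
  by rewrite Fp leNgt d0.
apply: (@le_trans _ _ ((\sum_(n < N) I (G n)) + e)%:E).
  rewrite lee_fin (le_trans (I_tsub (ltW d0) LF)) // lerD // -I_sum //.
  apply: (pf_le LI) => // [|p]; first exact: L_sum.
  have G_ge0 : 0 <= \sum_(n < N) G n p.
    by apply: sumr_ge0 => n _; exact: (pf_ge0 LI).
  rewrite /tsub ge_max G_ge0 andbT; have [dF|Fd] := leP d (F p).
    by rewrite (le_trans _ (GK _ dF)) // (le_trans _ (F1 p)) // gerBl ltW.
  by rewrite (le_trans _ G_ge0) // subr_le0 ltW.
rewrite EFinD leeD2r // -sumEFin (le_trans _ (nneseries_lim_ge N _)) //.
by rewrite big_mkord lee_sum // => n _; apply: I_le_lam; split;
  [exact: LG|exact: G1|exact: G0].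
Qed.

(** * The outer measure induced by the content *)

Definition riesz_outer (A : set T) : \bar R :=
  ereal_inf [set riesz_content U | U in [set U | open U /\ A `<=` U]].

Let mu_le A U : open U -> A `<=` U -> (riesz_outer A <= riesz_content U)%E.
Proof. by move=> oU AU; apply: ereal_inf_lbound; exists U. Qed.

Let mu_open U : open U -> riesz_outer U = riesz_content U.
Proof.
move=> oU; apply/eqP; rewrite eq_le mu_le //=.
by apply: le_ereal_inf_tmp => _ [V [oV UV] <-]; exact: le_lam.
Qed.

Let mu_ge0 A : (0 <= riesz_outer A)%E.
Proof. by apply: le_ereal_inf_tmp => _ [V _ <-]; exact: lam_ge0. Qed.

Let mu_fin A : riesz_outer A \is a fin_num.
Proof.
rewrite ge0_fin_numE //; apply: (@le_lt_trans _ _ (riesz_content setT)).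
  by apply: mu_le => //; exact: openT.
by rewrite -ge0_fin_numE.
Qed.

Let mu0 : riesz_outer set0 = 0.
Proof.
rewrite mu_open; last exact: open0.
apply/eqP; rewrite eq_le lam_ge0 andbT; apply: ge_ereal_sup => _ [F [_ _ F0] <-].
by rewrite lee_fin -I_zero (_ : F = fun=> 0) //; apply/funext => p; exact: F0.
Qed.

Let le_mu : {homo riesz_outer : A B / A `<=` B >-> (A <= B)%E}.
Proof.
move=> A B AB; apply: le_ereal_inf_tmp => _ [V [oV BV] <-].
by apply: mu_le => //; exact: subset_trans BV.
Qed.

Let mu_approx A (e : R) : 0 < e ->
  exists U, [/\ open U, A `<=` U & (riesz_content U <= riesz_outer A + e%:E)%E].
Proof.
move=> e0; have [_ [U [oU AU] <-] /ltW] := lb_ereal_inf_adherent e0 (mu_fin A).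
by exists U.
Qed.

Let mu_sigma_subadditive : sigma_subadditive riesz_outer.
Proof.
move=> A; apply/lee_addgt0Pr => e e0.
have en n : 0 < e / (2 ^ n.+1)%:R by rewrite divr_gt0 // ltr0n expn_gt0.
have /choice[U UP] n := mu_approx (A n) (en n).
have oU : open (\bigcup_n U n) by apply: bigcup_open => n _; have [] := UP n.
have AU : \bigcup_n A n `<=` \bigcup_n U n.
  by move=> p [n _ Anp]; exists n => //; have [_ + _] := UP n; apply.
apply: (le_trans (mu_le oU AU)); apply: (le_trans (lam_bigcup _)).
  by move=> n; have [] := UP n.
apply: (le_trans _ (epsilon_trick xpredT (fun n => mu_ge0 (A n)) (ltW e0))).
by apply: lee_nneseries => // n _; have [] := UP n.
Qed.

Let mu_outer : isOuterMeasure R T riesz_outer :=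
  isOuterMeasure.Build R T riesz_outer mu0 mu_ge0 le_mu mu_sigma_subadditive.

Let mo : {outer_measure set T -> \bar R} := HB.pack riesz_outer mu_outer.

(** Let [V] be open containing [X], and [F] a test function below [V] intersected with [U]. Removing
    the closed set where [d <= F] from [V] leaves an open [V'] that still contains [X] minus [U]. A
    function [G] below [V'] vanishes wherever [(F - d)^+] is positive, so their sum is again below
    [V], and additivity of [I] gives the inequality up to [e]. *)
Let open_caratheodory U : open U -> mo.-caratheodory U.
Proof.
move=> oU; apply: le_caratheodory_measurable => X.
rewrite [leRHS]/=; apply: le_ereal_inf_tmp => _ [V [oV XV] <-].
apply: (@le_trans _ _ (riesz_content (V `&` U) + riesz_outer (X `&` ~` U))%E).
  rewrite leeD2r // mu_le //; first exact: openI.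
  exact: setSI.
rewrite -leeBrDr //; apply: ge_ereal_sup => _ [F [LF F1 F0] <-].
rewrite leeBrDr //; apply/lee_addgt0Pr => e /small[d d0 de].
have LFd := pf_tsub LI LF (L_cst (ltW d0)).
pose V' := V `&` ~` [set p | d <= F p].
have oV' : open V'.
  apply: openI => //; apply: closed_openC; exact: closedF_ge.
have XV' : X `&` ~` U `<=` V'.
  move=> p [Xp Up]; split; first exact: XV.
  by rewrite /= F0 ?leNgt ?d0 //; case.
apply: (@le_trans _ _ ((I F)%:E + riesz_content V')%E); first by rewrite leeD2l // mu_le.
rewrite addeC -leeBrDr //; apply: ge_ereal_sup => _ [G [LG G1 G0] <-].
rewrite leeBrDr // -EFinD.
apply: (@le_trans _ _ ((I (fun p => G p + tsub F (fun=> d) p)) + e)%:E).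
  rewrite lee_fin (pf_intD LI) // -addrA lerD2l.
  by rewrite (le_trans (I_tsub (ltW d0) LF)) // lerD2l.
rewrite EFinD leeD2r //; apply: I_le_lam; split.
- exact: (pf_add LI).
- move=> p; have [dF|Fd] := leP d (F p).
    rewrite G0 ?add0r; last by case.
    rewrite /tsub ge_max ler01 andbT (le_trans _ (F1 p)) // gerBl; exact: ltW.
  by rewrite /tsub max_r ?addr0 // subr_le0 ltW.
- move=> p Vp; rewrite G0; last by case.
  rewrite add0r /tsub F0; last by case.
  by rewrite max_r // sub0r oppr_le0 ltW.
Qed.

Let borel_caratheodory : @measurable _ (borel T) `<=` mo.-caratheodory.
Proof.
apply: (@smallest_sub _ (sigma_algebra [set: T]) (@open T)).
  exact: (@sigma_algebra_measurable _ (caratheodory_type mo)).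
exact: open_caratheodory.
Qed.

Let W0 (A : set (borel T)) : \bar R := riesz_outer A.

Let W0_sigma_additive : semi_sigma_additive W0.
Proof.
move=> A mA tA mU.
apply: (@caratheodory_measure_sigma_additive R T mo A) => //.
  by move=> n; exact: borel_caratheodory.
exact: borel_caratheodory.
Qed.

Let W_exists :
  exists W : {finite_measure set (borel T) -> \bar R}, forall A, W A = riesz_outer A.
Proof.
pose W0m := isMeasure.Build _ (borel T) R W0 mu0 mu_ge0 W0_sigma_additive.
pose W1 : {measure set (borel T) -> \bar R} := HB.pack W0 W0m.
have W1_fin : fin_num_fun W1 by move=> A _; exact: mu_fin.
pose W0f := @Measure_isFinite.Build _ (borel T) R W1 W1_fin.
pose W : {finite_measure set (borel T) -> \bar R} := HB.pack W0 W0m W0f.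
by exists W.
Qed.

(** * Integrals of test functions against Borel measures *)

Let measurable_open (U : set T) : open U -> measurable (U : set (borel T)).
Proof. exact: sub_sigma_algebra. Qed.


Lemma continuous_borel_measurable (F : T -> R) : continuous F ->
  measurable_fun [set: borel T] (F : borel T -> R).
Proof.
move=> /continuousP cF.
apply: (measurability _ (RGenOpens.measurableE R)).
move=> _ [_ [a [b ->] <-]]; rewrite setTI.
apply: measurable_open; apply: cF; exact: interval_open.
Qed.

Let sum_steps_ge (v : R) n : 0 <= v -> v <= n%:R ->
  v <= \sum_(k < n) Num.min (Num.max (v - k%:R) 0) 1.
Proof.
move=> v0 vn.
(* The slices of [v] between consecutive integers are stacked up by induction on the height [m],
   which reaches [v] once [m = n]. *)
suff H m : Num.min v m%:R <= \sum_(k < m) Num.min (Num.max (v - k%:R) 0) 1.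
  by rewrite (le_trans _ (H n)) // le_min lexx vn.
elim: m => [|m IH]; first by rewrite big_ord0 ge_min lexx orbT.
rewrite big_ord_recr /=; apply: le_trans (lerD IH (lexx _)).
rewrite -natr1 /Num.max /Num.min; do !case: ifPn; lra.
Qed.

Let sum_jumps_le (v : R) n : 0 <= v ->
  \sum_(k < n) (k%:R < v)%R%:R <= v + 1.
Proof.
move=> v0; suff H : \sum_(k < n) (k%:R < v)%R%:R <= Num.min n%:R (v + 1).
  by rewrite (le_trans H) // ge_min lexx orbT.
elim: n => [|n IH]; first by rewrite big_ord0 le_min lexx addr_ge0.
rewrite big_ord_recr /=; apply: le_trans (lerD IH (lexx _)) _.
rewrite -natr1 /Num.min; have [nv|vn] := ltP n%:R v => /=; do !case: ifPn; lra.
Qed.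

Let integral_L_ge0 (V : {measure set (borel T) -> \bar R}) F : L F ->
  (0 <= \int[V]_p (F p)%:E)%E.
Proof. by move=> LF; apply: integral_ge0 => p _; rewrite lee_fin (pf_ge0 LI). Qed.

Let measurable_L F : L F -> measurable_fun [set: borel T] (fun p : borel T => (F p)%:E).
Proof.
move=> /(pf_cont LI) cF; apply/measurable_EFinP.
exact: continuous_borel_measurable.
Qed.

Let integral_L_D (V : {measure set (borel T) -> \bar R}) F G : L F -> L G ->
  (\int[V]_p (F p + G p)%:E = \int[V]_p (F p)%:E + \int[V]_p (G p)%:E)%E.
Proof.
move=> LF LG; rewrite -ge0_integralD //.
- by move=> p _; rewrite lee_fin (pf_ge0 LI).
- exact: measurable_L.
- by move=> p _; rewrite lee_fin (pf_ge0 LI).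
- exact: measurable_L.
Qed.

Let integral_L_Z (V : {measure set (borel T) -> \bar R}) c F : 0 <= c -> L F ->
  (\int[V]_p (c * F p)%:E = c%:E * \int[V]_p (F p)%:E)%E.
Proof.
move=> c0 LF; rewrite -ge0_integralZl_EFin //.
- by move=> p _; rewrite lee_fin (pf_ge0 LI).
- exact: measurable_L.
Qed.

(** The smaller function is only asked to be measurable, because it will also be an indicator or a
    finite sum of indicators. *)
Let integral_L_le (V : {measure set (borel T) -> \bar R}) F (f : borel T -> R) :
  L F -> measurable_fun setT f -> (forall p, 0 <= f p) -> (forall p, f p <= F p) ->
  (\int[V]_p (f p)%:E <= \int[V]_p (F p)%:E)%E.
Proof.
move=> LF mf f0 fF; apply: ge0_le_integral => //.
- by move=> p _; rewrite lee_fin.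
- exact/measurable_EFinP.
- exact: measurable_L.
- by move=> p _; rewrite lee_fin.
Qed.

(** * Regularity of the Riesz measure and comparison with the functional *)

Section representation.
Variable W : {measure set (borel T) -> \bar R}.
Hypothesis WE : forall A, W A = riesz_outer A.

Let W_open U : open U -> W U = riesz_content U. Proof. by rewrite WE; exact: mu_open. Qed.

Let W_setC (A : set (borel T)) : measurable A -> (W A = W setT - W (~` A))%E.
Proof.
move=> mA; rewrite -[W setT](_ : (W A + W (~` A) = _)%E); last first.
  by rewrite -measureU ?setUv ?setICr //; exact: measurableC.
by rewrite addeK // WE; exact: mu_fin.
Qed.

(** Outer regularity is built into [riesz_outer]. For inner regularity, an open set approximating
    the complement of [A] from outside has a compact complement inside [A]; finiteness of the
    measure lets the error pass to complements. *)
Lemma riesz_regular : regular_measure W.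
Proof.
move=> A mA; split.
  rewrite WE /riesz_outer; congr (ereal_inf _).
  apply/seteqP; split=> _ [U [oU AU] <-]; exists U => //; first exact: W_open.
  by symmetry; exact: W_open.
apply/eqP; rewrite eq_le; apply/andP; split; last first.
  by apply: ge_ereal_sup => _ [K [cK KA] <-]; rewrite !WE; exact: le_mu.
apply/lee_addgt0Pr => e e0.
have [U [oU AU Ue]] := mu_approx (~` A) e0.
apply: (@le_trans _ _ (W (~` U) + e%:E)%E).
  rewrite (W_setC mA) (W_setC (measurableC (measurable_open oU))) setCK.
  rewrite (W_open oU).
  have : W (~` A) \is a fin_num by rewrite WE; exact: mu_fin.
  have : W setT \is a fin_num by rewrite WE; exact: mu_fin.
  move: Ue; rewrite -(WE (~` A)) -(fineK (lam_fin U)) => + fT fA.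
  rewrite -(fineK fT) -(fineK fA) -!EFinD !lee_fin; lra.
rewrite leeD2r //; apply: ereal_sup_ubound; exists (~` U) => //; split.
  by apply: subclosed_compact cptT _ => //; exact: open_closedC.
by move=> p Up; apply: contrapT => /AU.
Qed.

Lemma riesz_total : W setT = (I (fun=> 1))%:E.
Proof.
rewrite W_open; last exact: openT.
apply/eqP; rewrite eq_le lam_le1 I_le_lam //.
by split => // [|p []//]; exact: pf_one LI.
Qed.

(* Layer cake: n F is the sum over k < n of the functions min (n F - k)^+ 1, each
   supported in {k < n F}, and the indicators of these sets add up to at most
   n F + 1. *)
Let I_le_integral_scaled F n : L F -> (forall p, F p <= 1) ->
  ((n%:R * I F)%:E <= n%:R%:E * \int[W]_p (F p)%:E + (I (fun=> 1))%:E)%E.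
Proof.
move=> LF F1.
pose v p := n%:R * F p; have Lv : L v by exact: (pf_scale LI).
have v0 p : 0 <= v p by exact: (pf_ge0 LI).
pose G (k : nat) p := Num.min (tsub v (fun=> k%:R) p) 1.
have LG k : L (G k).
  by apply: L_min; [apply: (pf_tsub LI) => //; exact: L_cst|exact: (pf_one LI)].
have mU k : measurable ([set p | k%:R < v p] : set (borel T)).
  by apply: measurable_open; exact: openF_gt.
have mjump k : measurable_fun [set: borel T] (fun p : borel T => (k%:R < v p)%R%:R : R).
  rewrite (_ : (fun _ => _) = \1_([set p | k%:R < v p] : set (borel T))).
    exact: (measurable_indic (mU k)).
  by apply/funext => p; rewrite indicE mem_setE.
have IW : ((n%:R * I F)%:E <= \sum_(k < n) W [set p | (k%:R < v p)%R])%E.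
  apply: (@le_trans _ _ (\sum_(k < n) I (G k))%:E).
    rewrite lee_fin -(pf_intZ LI) // -(I_sum (index_enum 'I_n) (fun k => LG k)).
    apply: (pf_le LI) => //; first exact: L_sum.
    by move=> p; apply: sum_steps_ge; [exact: v0|rewrite /v ler_piMr].
  rewrite -sumEFin lee_sum // => k _; rewrite W_open; last exact: openF_gt.
  apply: I_le_lam; split => // [p|p /= /negP]; first by rewrite ge_min lexx orbT.
  by rewrite -leNgt /G /tsub -subr_le0 => /max_idPr ->; rewrite min_l.
apply: (le_trans IW).
have -> : (\sum_(k < n) W [set p | (k%:R < v p)%R] =
    \int[W]_p \sum_(k < n) ((k%:R < v p)%R%:R)%:E)%E.
  rewrite ge0_integral_sum //.
    apply: eq_bigr => k _; transitivity (W ([set p | k%:R < v p] `&` setT)).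
      by rewrite setIT.
    by rewrite -integral_indic //; apply: eq_integral => p _; rewrite indicE mem_setE.
  by move=> k; apply/measurable_EFinP.
have L1 := pf_one LI.
rewrite -integral_L_Z // -riesz_total -[W setT]mul1e -integral_cst // -integral_L_D //.
under eq_integral do rewrite sumEFin.
apply: integral_L_le; first exact: (pf_add LI).
- exact: measurable_sum.
- by move=> p; rewrite sumr_ge0.
- by move=> p; apply: sum_jumps_le.
Qed.

Lemma riesz_integral_fin F : L F -> (forall p, F p <= 1) ->
  (\int[W]_p (F p)%:E)%E \is a fin_num.
Proof.
move=> LF F1; have L1 := pf_one LI.
rewrite ge0_fin_numE ?integral_L_ge0 //.
apply: (@le_lt_trans _ _ (\int[W]_p 1%:E)%E).
  apply: integral_L_le => //; last by move=> p; exact: (pf_ge0 LI).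
  exact: continuous_borel_measurable (pf_cont LI LF).
by rewrite integral_cst // mul1e riesz_total ltry.
Qed.

Lemma riesz_le_integral F : L F -> (forall p, F p <= 1) ->
  ((I F)%:E <= \int[W]_p (F p)%:E)%E.
Proof.
move=> LF F1; have L1 := pf_one LI; have c0 := I_ge0 L1.
have Ffin := riesz_integral_fin LF F1.
rewrite -(fineK Ffin) lee_fin; set J := fine _.
apply/ler_addgt0Pr => e e0.
(* With [n] larger than [I (fun=> 1) / e], dividing the scaled inequality by [n] leaves an error
   below [e]. *)
have := archi_boundP (divr_ge0 c0 (ltW e0)); set n := Num.bound _.
rewrite ltr_pdivrMr // => cn.
have n0 : (0 < n%:R :> R).
  by rewrite ltNge; apply/negP => n0; have := le_lt_trans c0 cn; nra.
have := I_le_integral_scaled n LF F1.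
rewrite -[X in (_ <= _ * X + _)%E]fineK //.
rewrite -EFinM -EFinD lee_fin -/J => H.
rewrite -(ler_pM2l n0); nra.
Qed.

End representation.

Let L_bounded F : L F -> exists2 M : R, 0 < M & forall p, F p <= M.
Proof.
move=> /(pf_cont LI) /(continuous_bounded_compact cptT)[M M0 FM].
by exists M => // p; exact: le_trans (ler_norm _) (FM p).
Qed.

(** Scaling reduces to [F <= 1]. There the inequality between functional and integral holds for both
    [F] and [1 - F], while the two sides have equal sums because the total mass is [I (fun=> 1)];
    hence both inequalities are equalities. *)
Theorem riesz_markov : exists2 V : {finite_measure set (borel T) -> \bar R},
  regular_measure V & forall F, L F -> (\int[V]_p (F p)%:E = (I F)%:E)%E.
Proof.
have [W WE] := W_exists; exists W; first exact: riesz_regular.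
have L1 := pf_one LI.
suff H : forall F, L F -> (forall p, F p <= 1) -> (\int[W]_p (F p)%:E = (I F)%:E)%E.
  move=> F LF; have [M M0 FM] := L_bounded LF.
  have Mi0 : 0 <= M^-1 by rewrite invr_ge0 ltW.
  have := H _ (pf_scale LI Mi0 LF).
  rewrite (pf_intZ LI) // integral_L_Z // => HF.
  have FM1 p : M^-1 * F p <= 1 by rewrite mulrC ler_pdivrMr // mul1r.
  have /(congr1 (fun z => (M%:E * z)%E)) := HF FM1.
  by rewrite muleA -!EFinM mulrA divff ?gt_eqF // mul1e mul1r.
move=> F LF F1; pose G := tsub (fun=> 1) F.
have LG : L G by exact: (pf_tsub LI).
have FG : (fun p => F p + G p) = fun=> 1.
  by apply/funext => p; rewrite /G /tsub max_l ?subr_ge0 // addrC subrK.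
have G1 p : G p <= 1.
  by rewrite -[leRHS](congr1 (@^~ p) FG) lerDr (pf_ge0 LI).
have IF := riesz_le_integral WE LF F1; have IG := riesz_le_integral WE LG G1.
have := integral_L_D W LF LG; have := pf_intD LI LF LG.
rewrite FG; under eq_integral do rewrite (congr1 (@^~ _) FG).
rewrite integral_cst // mul1e (riesz_total WE) => I1.
have fF := riesz_integral_fin WE LF F1; have fG := riesz_integral_fin WE LG G1.
move: IF IG; rewrite -(fineK fF) -(fineK fG) -EFinD !lee_fin => IF IG [].
by rewrite I1 => ?; congr EFin; lra.
Qed.

(* Closed sets are compared rather than compact ones: T is not assumed to be
   Hausdorff, so a compact set need not be measurable. *)
Lemma regular_measure_unique (V V' : {finite_measure set (borel T) -> \bar R}) :
  regular_measure V -> regular_measure V' ->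
  (forall F, L F -> (\int[V]_p (F p)%:E = \int[V']_p (F p)%:E)%E) ->
  forall A, measurable A -> V A = V' A.
Proof.
have mclosed (C : set T) : closed C -> measurable (C : set (borel T)).
  move=> clC; rewrite -[C]setCK; apply: measurableC; apply: measurable_open.
  exact: closed_openC.
(* A bump [G] equal to 1 on [C] and vanishing off [U] gives [Z C <= \int G dZ = \int G dZ' <= Z' U];
   outer regularity of [Z'] then takes the infimum over [U]. *)
have Vclosed (Z Z' : {measure set (borel T) -> \bar R}) : regular_measure Z' ->
    (forall F, L F -> (\int[Z]_p (F p)%:E = \int[Z']_p (F p)%:E)%E) ->
    forall C : set (borel T), closed (C : set T) -> (Z C <= Z' C)%E.
  move=> rZ' ZZ' C clC; have mC := mclosed _ clC.
  have [-> _] := rZ' _ mC; apply: le_ereal_inf_tmp => _ [U [oU CU] <-].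
  have mU : measurable (U : set (borel T)) by exact: measurable_open.
  have cC : compact (C : set T) by apply: subclosed_compact cptT _.
  have [G [LG G1 G0 GC]] := bump cC oU CU.
  have VG : (Z C <= \int[Z]_p (G p)%:E)%E.
    rewrite -[C]setIT -integral_indic //; apply: integral_L_le => //.
    move=> p; rewrite indicE; have [/set_mem /GC -> //|_] := boolP (p \in C).
    exact: (pf_ge0 LI).
  have GV' : (\int[Z']_p (G p)%:E <= Z' U)%E.
    rewrite -[U]setIT -integral_indic //; apply: ge0_le_integral => //.
    - by move=> p _; rewrite lee_fin (pf_ge0 LI).
    - exact: measurable_L.
    - apply/measurable_EFinP; exact: (measurable_indic mU).
    - move=> p _; rewrite lee_fin indicE.
      by have [_|/negP/(contra_not mem_set)/G0 -> //] := boolP (p \in U).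
  by rewrite (le_trans VG) // ZZ'.
move=> rV rV' VV' A mA.
(* Open sets follow by complementation, since the total masses agree and are finite; outer
   regularity then reaches all Borel sets. *)
have Vo U : open U -> V U = V' U.
  move=> oU; have clU : closed (~` U) by exact: open_closedC.
  have mU : measurable (U : set (borel T)) by exact: measurable_open.
  have VT : V setT = V' setT.
    by have := VV' _ (pf_one LI); rewrite !integral_cst // !mul1e.
  have VC : V (~` U) = V' (~` U).
    by apply/eqP; rewrite eq_le !Vclosed // => F /VV'.
  have split (Z : {finite_measure set (borel T) -> \bar R}) :
      (Z U = Z setT - Z (~` U))%E.
    rewrite -[Z setT](_ : (Z U + Z (~` U) = _)%E); last first.
      by rewrite -measureU ?setUv ?setICr //; exact: measurableC.
    by rewrite addeK //; apply: fin_num_measure; exact: measurableC.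
  by rewrite split VT VC -split.
have [VA _] := rV _ mA; have [VA' _] := rV' _ mA; rewrite VA VA'; apply: congr1.
apply/seteqP; split=> _ [U [oU AU] <-]; exists U => //; last exact: Vo.
by symmetry; exact: Vo.
Qed.

End RieszMarkov.

(** * Heat kernels and iterated integrals *)

Section HeatKernel.
Context {R : realType}.
Implicit Types D z s r a b : R.

Lemma heat_kernel_ge0 D z s : 0 <= heat_kernel D z s.
Proof. by rewrite mulr_ge0 ?invr_ge0 ?sqrtr_ge0 ?expR_ge0. Qed.

Lemma measurable_heat_kernel D s d (X : measurableType d) (f : X -> R) :
  measurable_fun setT f -> measurable_fun setT (fun i => heat_kernel D (f i) s).
Proof.
move=> mf; apply: measurable_funM => //; apply: measurableT_comp => //.
apply: measurableT_comp => //; apply: measurable_funM => //.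
by apply: measurable_funX; apply: measurableT_comp.
Qed.

(* Completing the square: the product is a Gaussian in z, times a constant. *)
Lemma heat_kernelM D a b z r s : 0 < D -> 0 < r -> 0 < s ->
  heat_kernel D (b - z) r * heat_kernel D (z - a) s =
  heat_kernel D (b - a) (r + s) *
    normal_pdf ((s * b + r * a) / (r + s))
      (Num.sqrt (2 * D * (r * s / (r + s)))) z.
Proof.
move=> D0 r0 s0; have rs0 : 0 < r + s by exact: addr_gt0.
have pi0 := pi_gt0 R.
have v0 : 0 < 2 * D * (r * s / (r + s)).
  by rewrite !mulr_gt0 ?invr_gt0.
rewrite normal_pdfE ?gt_eqF ?sqrtr_gt0 //.
rewrite /heat_kernel /normal_peak /normal_fun !sqr_sqrtr ?ltW //.
rewrite mulrACA -expRD [RHS]mulrACA -expRD -!invfM; congr (_^-1 * expR _).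
  rewrite -!sqrtrM; first by congr (Num.sqrt _); rewrite -mulr_natr; field; lra.
    by rewrite !mulr_ge0 // ltW.
  by rewrite !mulr_ge0 // ltW.
by rewrite !real_normK ?num_real // -mulr_natr; field; rewrite ?gt_eqF //; lra.
Qed.

Lemma chapman_kolmogorov D a b r s : 0 < D -> 0 < r -> 0 < s ->
  (\int[lebesgue_measure]_z (heat_kernel D (b - z) r * heat_kernel D (z - a) s)%:E
   = (heat_kernel D (b - a) (r + s))%:E)%E.
Proof.
move=> D0 r0 s0; under eq_integral do rewrite heat_kernelM // EFinM.
rewrite ge0_integralZl_EFin //.
- by rewrite integral_normal_pdf mule1.
- by move=> z _; rewrite lee_fin normal_pdf_ge0.
- by apply/measurable_EFinP; exact: measurable_normal_pdf.
- exact: heat_kernel_ge0.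
Qed.

End HeatKernel.

(** Integration variables are written into a total function of time, so that one functional of paths
    can be integrated over grids of any length without changing the type of its argument. *)
Definition upd (R : realType) (h : R -> R) (s z : R) : R -> R :=
  fun u => if u == s then z else h u.

(* The times are listed in decreasing order, as in iterated_integral the last
   coordinate is integrated outermost. *)
Fixpoint chain (R : realType) (D x : R) (H : (R -> R) -> R)
    (ss : seq R) (tau b : R) (h : R -> R) : \bar R :=
  match ss with
  | [::] => (heat_kernel D (b - x) (tau - 0) * H h)%:E
  | s :: ss' => (\int[lebesgue_measure]_z
      ((heat_kernel D (b - z) (tau - s))%:E * chain D x H ss' s z (upd h s z)))%E
  end.

(** Measurability is tested along families of paths indexed by an arbitrary measurable space. This
    avoids choosing a sigma-algebra on [R -> R] and is stable under updating a path with further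
    integration variables. *)
Definition path_measurable (R : realType) (H : (R -> R) -> R) : Prop :=
  forall d (X : measurableType d) (h : X -> R -> R),
    (forall u, measurable_fun setT (h^~ u)) -> measurable_fun setT (H \o h).

Lemma rev_path_lt (R : realType) (u v : R) (r : seq R) :
  path >%R v (rcons (rev r) u) = path <%R u (rcons r v).
Proof.
rewrite -[path _ u _]/(sorted _ (u :: rcons r v)).
rewrite -[path _ v _]/(sorted _ (v :: rcons (rev r) u)).
by rewrite -rcons_cons -rev_rcons -rev_cons rev_sorted.
Qed.

(** * Iterated integrals along a chain of times *)

Section Chain.
Context {R : realType}.
Variables (D x : R).
Hypothesis D0 : 0 < D.
Implicit Types (H : (R -> R) -> R) (ss : seq R) (tau b s : R) (h : R -> R).
Local Notation leb := (@lebesgue_measure R).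

Lemma measurable_upd d (X : measurableType d) (h : X -> R -> R) s (z : X -> R) :
  (forall u, measurable_fun setT (h^~ u)) -> measurable_fun setT z ->
  forall u, measurable_fun setT (fun a => upd (h a) s (z a) u).
Proof.
move=> mh mz u; rewrite /upd; case: (u == s); [exact: mz|exact: mh].
Qed.

Lemma chain_ge0 H ss tau b h : (forall h, 0 <= H h) ->
  (0 <= chain D x H ss tau b h)%E.
Proof.
move=> H0; elim: ss tau b h => [|s ss IH] tau b h /=.
  by rewrite lee_fin mulr_ge0 // heat_kernel_ge0.
by apply: integral_ge0 => z _; rewrite mule_ge0 // lee_fin heat_kernel_ge0.
Qed.

(** The induction generalises over the parameter space: the integration variable becomes the second
    component of [X * R], and Tonelli's theorem gives measurability of the partial integral. *)
Lemma measurable_chain H ss tau d (X : measurableType d) (b : X -> R)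
    (h : X -> R -> R) :
  (forall h, 0 <= H h) -> path_measurable H ->
  measurable_fun setT b -> (forall u, measurable_fun setT (h^~ u)) ->
  measurable_fun setT (fun a => chain D x H ss tau (b a) (h a)).
Proof.
move=> H0 mH; elim: ss tau d X b h => [|s ss IH] tau d X b h mb mh /=.
  apply/measurable_EFinP; apply: measurable_funM; last exact: mH.
  by apply: measurable_heat_kernel; exact: measurable_funB.
apply: (@measurable_fun_fubini_tonelli_F _ _ X _ _ leb
  (fun p => (heat_kernel D (b p.1 - p.2) (tau - s))%:E *
            chain D x H ss s p.2 (upd (h p.1) s p.2))%E).
  apply: emeasurable_funM.
    apply/measurable_EFinP; apply: measurable_heat_kernel.
    apply: measurable_funB; last exact: measurable_snd.
    by apply: (measurableT_comp mb); exact: measurable_fst.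
  apply: IH; first exact: measurable_snd.
  apply: measurable_upd; last exact: measurable_snd.
  by move=> u; apply: (measurableT_comp (mh u)); exact: measurable_fst.
by move=> p; rewrite mule_ge0 ?chain_ge0 // lee_fin heat_kernel_ge0.
Qed.

Let step_measurable H ss tau s b (h : R -> R -> R) :
  (forall h, 0 <= H h) -> path_measurable H ->
  (forall u, measurable_fun setT (h^~ u)) ->
  measurable_fun [set: R] (fun z =>
    (heat_kernel D (b - z) (tau - s))%:E * chain D x H ss s z (h z))%E.
Proof.
move=> H0 mH mh; apply: emeasurable_funM.
  by apply/measurable_EFinP; apply: measurable_heat_kernel; exact: measurable_funB.
exact: measurable_chain.
Qed.

Let step_ge0 H ss tau s b h z : (forall h, 0 <= H h) ->
  (0 <= (heat_kernel D (b - z) (tau - s))%:E * chain D x H ss s z h)%E.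
Proof. by move=> H0; rewrite mule_ge0 ?chain_ge0 // lee_fin heat_kernel_ge0. Qed.

Let measurable_upd1 h s u : measurable_fun [set: R] (fun z => upd h s z u).
Proof. exact: (@measurable_upd _ _ (fun=> h) s id). Qed.

Lemma chain_le H1 H2 ss tau b h :
  (forall h, 0 <= H1 h) -> path_measurable H1 -> path_measurable H2 ->
  (forall h, H1 h <= H2 h) ->
  (chain D x H1 ss tau b h <= chain D x H2 ss tau b h)%E.
Proof.
move=> H10 mH1 mH2 H12.
have H20 k : 0 <= H2 k by exact: le_trans (H12 k).
elim: ss tau b h => [|s ss IH] tau b h /=.
  by rewrite lee_fin ler_wpM2l // heat_kernel_ge0.
apply: ge0_le_integral => //.
- by move=> z _; exact: step_ge0.
- exact: step_measurable.
- exact: step_measurable.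
- by move=> z _; rewrite lee_wpmul2l // lee_fin heat_kernel_ge0.
Qed.

Lemma chainD H1 H2 ss tau b h :
  (forall h, 0 <= H1 h) -> path_measurable H1 ->
  (forall h, 0 <= H2 h) -> path_measurable H2 ->
  (chain D x (fun h => (H1 h + H2 h)%R) ss tau b h =
   chain D x H1 ss tau b h + chain D x H2 ss tau b h)%E.
Proof.
move=> H10 mH1 H20 mH2; elim: ss tau b h => [|s ss IH] tau b h /=.
  by rewrite mulrDr EFinD.
rewrite -ge0_integralD //.
- by apply: eq_integral => z _; rewrite IH ge0_muleDr // chain_ge0.
- by move=> z _; exact: step_ge0.
- exact: step_measurable.
- by move=> z _; exact: step_ge0.
- exact: step_measurable.
Qed.

Lemma chainZ (c : R) H ss tau b h :
  0 <= c -> (forall h, 0 <= H h) -> path_measurable H ->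
  (chain D x (fun h => (c * H h)%R) ss tau b h =
   c%:E * chain D x H ss tau b h)%E.
Proof.
move=> c0 H0 mH; elim: ss tau b h => [|s ss IH] tau b h /=.
  by rewrite mulrCA EFinM.
rewrite -ge0_integralZl_EFin //.
- by apply: eq_integral => z _; rewrite IH muleCA.
- by move=> z _; exact: step_ge0.
- exact: step_measurable.
Qed.

Lemma chain_agree (A : set R) H ss tau b h h' :
  (forall h h', (forall u, A u -> h u = h' u) -> H h = H h') ->
  (forall u, A u -> h u = h' u) ->
  chain D x H ss tau b h = chain D x H ss tau b h'.
Proof.
move=> HA; elim: ss tau b h h' => [|s ss IH] tau b h h' hh' /=.
  by rewrite (HA _ _ hh').
apply: eq_integral => z _; congr (_ * _)%E; apply: IH => u Au.
by rewrite /upd hh'.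
Qed.

(** Since [h] is not updated at [s], the variable [z] occurs only in the two kernels adjacent to it.
    Tonelli's theorem moves its integral inside, where Chapman-Kolmogorov merges these kernels. For
    empty [ss] the earlier neighbour is the starting point [x] at time 0. *)
Lemma chain_semigroup H ss tau s b h :
  (forall h, 0 <= H h) -> path_measurable H ->
  s < tau -> path >%R s (rcons ss 0) ->
  (\int[leb]_z ((heat_kernel D (b - z) (tau - s))%:E * chain D x H ss s z h) =
   chain D x H ss tau b h)%E.
Proof.
move=> H0 mH st; case: ss => [|u ss] /= /andP[us ps].
  under eq_integral do rewrite -EFinM mulrA EFinM.
  rewrite ge0_integralZr //.
  - rewrite chapman_kolmogorov // ?subr_gt0 // -EFinM.
    by rewrite addrA subrK.
  - apply/measurable_EFinP; apply: measurable_funM; apply: measurable_heat_kernel;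
      exact: measurable_funB.
  - by move=> z _; rewrite lee_fin mulr_ge0 // heat_kernel_ge0.
  - by rewrite lee_fin.
pose f (p : R * R) := ((heat_kernel D (b - p.1) (tau - s))%:E *
  ((heat_kernel D (p.1 - p.2) (s - u))%:E * chain D x H ss u p.2 (upd h u p.2)))%E.
have mf : measurable_fun setT f.
  apply: emeasurable_funM.
    apply/measurable_EFinP; apply: measurable_heat_kernel.
    by apply: measurable_funB => //; exact: measurable_fst.
  apply: emeasurable_funM.
    apply/measurable_EFinP; apply: measurable_heat_kernel.
    by apply: measurable_funB; [exact: measurable_fst|exact: measurable_snd].
  apply: measurable_chain => //.
  exact: (@measurable_upd _ _ (fun=> h) u snd).
have f0 p : (0 <= f p)%E.
  by rewrite mule_ge0 ?step_ge0 // lee_fin heat_kernel_ge0.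
transitivity (\int[leb]_z \int[leb]_w f (z, w))%E.
  apply: eq_integral => z _; rewrite -ge0_integralZl_EFin //.
  - by move=> w _; exact: step_ge0.
  - exact: step_measurable.
  - exact: heat_kernel_ge0.
rewrite fubini_tonelli //; apply: eq_integral => w _.
under eq_integral do rewrite /f /= muleA -EFinM.
rewrite ge0_integralZr //.
- by rewrite chapman_kolmogorov // ?subr_gt0 // addrA subrK.
- apply/measurable_EFinP; apply: measurable_funM; apply: measurable_heat_kernel;
    exact: measurable_funB.
- by move=> z _; rewrite lee_fin mulr_ge0 // heat_kernel_ge0.
- exact: chain_ge0.
Qed.

(** Times that [H] ignores are integrated out one by one. This is what makes the functional
    independent of the grid. *)
Lemma chain_filter (P : pred R) H ss tau b h :
  (forall h, 0 <= H h) -> path_measurable H ->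
  path >%R tau (rcons ss 0) ->
  (forall h h', (forall u, P u -> h u = h' u) -> H h = H h') ->
  chain D x H ss tau b h = chain D x H (seq.filter P ss) tau b h.
Proof.
move=> H0 mH + HP; elim: ss tau b h => [//|s ss IH] tau b h /= /andP[st ps].
have [Ps|nPs] /= := boolP (P s).
  by apply: eq_integral => z _; rewrite IH.
rewrite -IH; last first.
  by case: ss ps {IH} => [|u ss] /= /andP[us ps]; rewrite (lt_trans us st) ?ps.
(* The ignored time [s] is put back by the semigroup property; the two sides then differ only by the
   update at [s], which [H] cannot see. *)
rewrite -(chain_semigroup _ _ H0 mH st ps).
apply: eq_integral => z _; congr (_ * _)%E.
apply: (chain_agree (A := [set u | P u])) => // u /= Pu.
by rewrite /upd; case: eqP Pu => // ->; rewrite (negbTE nPs).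
Qed.

(** A constant ignores every time, so the whole chain collapses to a single kernel. *)
Lemma chain_cst (c : R) ss tau b h : 0 <= c -> path >%R tau (rcons ss 0) ->
  chain D x (fun=> c) ss tau b h = (heat_kernel D (b - x) (tau - 0) * c)%:E.
Proof.
move=> c0 ps; rewrite (chain_filter (P := pred0)) // ?filter_pred0 //.
by move=> d X k _; exact: measurable_cst.
Qed.

Lemma chain_fin H ss tau b h (M : R) :
  (forall h, 0 <= H h) -> path_measurable H -> (forall h, H h <= M) ->
  path >%R tau (rcons ss 0) ->
  chain D x H ss tau b h \is a fin_num.
Proof.
move=> H0 mH HM ps; rewrite ge0_fin_numE ?chain_ge0 //.
have M0 : 0 <= M by exact: le_trans (HM h).
apply: le_lt_trans (chain_le ss tau b h H0 mH _ HM) _.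
  by move=> d X k _; exact: measurable_cst.
by rewrite chain_cst // ltry.
Qed.

(** * From chains to iterated integrals over tuples *)

Fixpoint upds h (ts zs : seq R) : R -> R :=
  if ts is t :: ts' then
    if zs is z :: zs' then upd (upds h ts' zs') t z else h
  else h.

Lemma upds_rcons h ts zs s z : size ts = size zs ->
  upds h (rcons ts s) (rcons zs z) = upds (upd h s z) ts zs.
Proof. by elim: ts zs => [|t ts IH] [|w zs] //= [/IH ->]. Qed.

Lemma upds_nth h ts zs i : uniq ts -> size ts = size zs -> (i < size ts)%N ->
  upds h ts zs (nth 0 ts i) = nth 0 zs i.
Proof.
elim: ts zs i => [//|u ts IH] [//|z zs] [|i] /= /andP[uts uniq_ts] [sz] isz.
  by rewrite /upd eqxx.
rewrite /upd; case: eqP => [e|_]; last exact: IH.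
by move: uts; rewrite -e mem_nth.
Qed.

Lemma kernel_product_rcons N (s z : seq R) tau b :
  size s = N.+2 -> size z = N.+2 ->
  kernel_product D N.+1 (rcons s tau) (rcons z b) =
  kernel_product D N s z * heat_kernel D (b - last 0 z) (tau - last 0 s).
Proof.
move=> ss sz; rewrite /kernel_product big_nat_recr //=; congr (_ * _).
  apply: eq_big_nat => i /andP[i0 iN]; rewrite !nth_rcons ss sz iN.
  by rewrite (leq_ltn_trans (leq_pred i) iN).
by rewrite !nth_rcons ss sz !ltnn !eqxx !ltnSn -!nth_last ss sz.
Qed.

(** A signed integrand is written as [H1 - H2] because chains are handled for nonnegative
    functionals; the bound [M] makes both chains finite. The factor [c] lets the induction push the
    kernel of the outermost variable into the inner iterated integral. *)
Lemma iterated_chain (M c : R) H1 H2 N (ts : seq R) tau b h :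
  (forall h, 0 <= H1 h) -> path_measurable H1 -> (forall h, H1 h <= M) ->
  (forall h, 0 <= H2 h) -> path_measurable H2 -> (forall h, H2 h <= M) ->
  0 <= c -> path <%R 0 (rcons ts tau) -> size ts = N ->
  (iterated_integral (fun zs : N.-tuple R =>
     ((H1 (upds h ts zs) - H2 (upds h ts zs)) *
      kernel_product D N (0 :: rcons ts tau) (x :: rcons zs b) * c)%:E) =
   c%:E * (chain D x H1 (rev ts) tau b h - chain D x H2 (rev ts) tau b h))%E.
Proof.
move=> H10 mH1 H1M H20 mH2 H2M.
elim: N ts tau b h c => [|N IH] ts tau b h c c0.
  case: ts => //= _ _; rewrite /kernel_product big_nat1 /= -EFinB -EFinM.
  by congr (_%:E); ring.
case/lastP: ts => // ts s; rewrite size_rcons => ps [sN].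
have pts : path <%R 0 (rcons ts s) by move: ps; rewrite rcons_path => /andP[].
rewrite rev_rcons /=.
have intch H : (forall h, 0 <= H h) -> path_measurable H ->
    (forall h, H h <= M) -> leb.-integrable setT (fun z =>
    (heat_kernel D (b - z) (tau - s))%:E *
      chain D x H (rev ts) s z (upd h s z))%E.
  move=> H0 mH HM; apply/integrableP; split; first exact: step_measurable.
  (* The integral of this nonnegative function is the chain over the full list of times, which is
     finite. *)
  under eq_integral do rewrite gee0_abs ?step_ge0 //.
  have := chain_fin b h H0 mH HM (etrans (rev_path_lt _ _ _) ps).
  by rewrite rev_rcons /= ge0_fin_numE // integral_ge0 // => z _; exact: step_ge0.
rewrite -integralB //; [|exact: intch|exact: intch].
rewrite -integralZl //; last by apply: integrableB => //; exact: intch.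
apply: eq_integral => z _.
have phi0 : 0 <= heat_kernel D (b - z) (tau - s) by exact: heat_kernel_ge0.
have /= := IH ts s z (upd h s z) (c * heat_kernel D (b - z) (tau - s)).
rewrite mulr_ge0 // => /(_ isT pts sN).
have f1 := chain_fin z (upd h s z) H10 mH1 H1M (etrans (rev_path_lt _ _ _) pts).
have f2 := chain_fin z (upd h s z) H20 mH2 H2M (etrans (rev_path_lt _ _ _) pts).
rewrite EFinM -muleA muleBr ?fin_num_adde_defr // => <-.
congr (iterated_integral _); apply/funext => zs.
rewrite upds_rcons ?size_tuple //; congr EFin.
rewrite -!rcons_cons kernel_product_rcons /= ?size_rcons ?size_tuple ?sN //.
by rewrite !last_rcons; ring.
Qed.

End Chain.

(** * The path space *)

(** At infinity, the complement of a closed bounded interval is a neighbourhood on which [f] is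
    constant. *)
Lemma opc_continuous (R : realType) (f : Rhat R -> R) (M : R) :
  continuous (fun z : R => f (Some z)) ->
  (forall z : R, M < `|z| -> f (Some z) = f None) -> continuous f.
Proof.
move=> fS fM [z|] U /= Uf; first exact: (fS z U Uf).
exists `[- `|M|, `|M|]%classic.
  split; first exact: segment_compact.
  exact: (@interval_closed R (BLeft (- `|M|)) (BRight `|M|)).
move=> _ [[z nz <-]|->] /=; last exact: nbhs_singleton Uf.
rewrite fM; first exact: nbhs_singleton Uf.
rewrite ltNge; apply/negP => zM; apply: nz; rewrite /= in_itv /= -ler_norml.
exact: le_trans (ler_norm M).
Qed.

Lemma opc_bump (R : realType) (p : Rhat R) (U : set (Rhat R)) : nbhs p U ->
  exists f : Rhat R -> R,
    [/\ continuous f, forall q, 0 <= f q, 0 < f p & forall q, ~ U q -> f q = 0].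
Proof.
have maxc (g : R -> R) : continuous g -> continuous (fun z => Num.max (g z) 0).
  by move=> cg z; apply: continuous_max; [exact: cg|exact: cvg_cst].
case: p => [a|] /=.
  move=> /nbhs_ballP[e /= e0 aeU].
  (* A tent over the ball of radius [e] around [a], extended by 0 to infinity. *)
  pose f (q : Rhat R) : R := if q is Some z then Num.max (e - `|z - a|) 0 else 0.
  exists f; split.
  - apply: (@opc_continuous _ f (`|a| + e)) => [|z aez].
      apply: (maxc _) => z; apply: cvgB; first exact: cvg_cst.
      by apply: cvg_norm; apply: cvgB; [exact: cvg_id|exact: cvg_cst].
    rewrite /f max_r // subr_le0; have := ler_normD (z - a) a; rewrite subrK.
    lra.
  - by case=> [z|] //=; rewrite le_max lexx orbT.
  - by rewrite /= subrr normr0 subr0 lt_max e0.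
  - case=> [z|] //= nU; rewrite max_r // subr_le0 leNgt; apply/negP => ze.
    by apply/nU/aeU; rewrite /ball /= distrC.
case=> K [/compact_bounded /pinfty_ex_gt0[M M0 KM] _] KU.
(* After truncation at 0, a ramp in the absolute value of [z]: 0 up to [M], hence on [K], and 1 from
   [M + 1] on and at infinity. *)
pose f (q : Rhat R) : R :=
  if q is Some z then 1 - Num.max (M + 1 - `|z|) 0 else 1.
have cn : continuous (fun z : R => Num.max (M + 1 - `|z|) 0).
  apply: (maxc _) => z; apply: cvgB; first exact: cvg_cst.
  by apply: cvg_norm; exact: cvg_id.
exists (fun q => Num.max (f q) 0); split.
- apply: (@opc_continuous _ _ (M + 1)) => [|z Mz].
    apply: (maxc _) => z; apply: cvgB; first exact: cvg_cst.
    exact: cn.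
  rewrite /f (_ : Num.max (M + 1 - `|z|) 0 = 0) ?subr0 //.
  by rewrite max_r // subr_le0 ltW.
- by move=> q; rewrite le_max lexx orbT.
- by rewrite /= lt_max ltr01.
- case=> [z|] nU; last by case: nU; apply: KU; right.
  have /KM : K z by apply: contrapT => nK; apply/nU/KU; left; exists z.
  move=> /= zM; apply/max_idPr; rewrite subr_le0 le_max; apply/orP; left; lra.
Qed.

Section PathSpace.
Context {R : realType} (t : R) (t0 : 0 < t) (x y : R).
Local Notation Omega := (path_space t0 x y).
Local Notation time := (`[0%R, t]%classic : Type).

(** Tychonoff applies to the product whose factors are a single point at each endpoint and all of
    [Rhat R] at interior times. *)
Lemma path_space_compact : compact [set: Omega].
Proof.
pose A (s : `[0%R, t]%classic) : set (Rhat R) :=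
  [set z | (set_val s = 0 -> z = Some x) /\ (set_val s = t -> z = Some y)].
have cA s : compact (A s).
  have [s0|s0] := eqVneq (set_val s) 0.
    rewrite (_ : A s = [set (Some x : Rhat R)]); first exact: compact_set1.
    apply/seteqP; split=> z; first by case=> + _; apply.
    by move=> ->; split=> // st; move: t0; rewrite -st s0 ltxx.
  have [st|st] := eqVneq (set_val s) t.
    rewrite (_ : A s = [set (Some y : Rhat R)]); first exact: compact_set1.
    apply/seteqP; split=> z; first by case=> _; apply.
    by move=> ->; split=> // s0'; move: t0; rewrite -st s0' ltxx.
  rewrite (_ : A s = setT); first exact: one_point_compactification_compact.
  apply/seteqP; split=> z // _; split=> e.
    by rewrite e eqxx in s0.
  by rewrite e eqxx in st.
have := tychonoff cA.
rewrite (_ : [set f | _] = fixed_endpoints t x y); last first.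
  apply/seteqP; split=> f /=.
    by move=> Af; split=> s e; have [? ?] := Af s; auto.
  by move=> [f0 f1] s; split; [exact: f0|exact: f1].
(* A filter on the subtype is pushed forward to the full product. Its cluster point there satisfies
   the endpoint conditions, and it is a cluster point in the subtype because open sets of the
   subtype are preimages. *)
move=> cF G PG _.
have GF : G (set_val @^-1` fixed_endpoints t x y).
  rewrite (_ : set_val @^-1` _ = setT); first exact: filterT.
  by apply/seteqP; split=> // g _; exact: (set_mem (valP g)).
have [p [Fp clp]] := cF (@fmap Omega (all_paths t) set_val G) _ GF.
exists (exist _ p (mem_set Fp)); split => // B C GB [_ [[V oV <-] /= Vp] VC].
have [|q [[g Bg <-] Vg]] := clp (set_val @` B) V _ (open_nbhs_nbhs (conj oV Vp)).
  have sub : B `<=` set_val @^-1` (set_val @` B) by move=> g Bg; exists g.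
  exact: filterS sub GB.
by exists g; split => //; exact: VC.
Qed.

Lemma path_eval_continuous (s : `[0%R, t]%classic) :
  continuous (fun g : Omega => path_eval g s).
Proof.
move=> g; apply: (@continuous_comp Omega (all_paths t) (Rhat R) set_val
  (fun f => f s)).
  exact: initial_continuous.
exact: (@proj_continuous _ (fun=> Rhat R) s).
Qed.

(** The subtype and product topologies are both initial, so convergence may be checked at each time
    separately. *)
Lemma path_cvg (G : set_system Omega) (FG : Filter G) (g : Omega) :
  (forall s, (fun g' : Omega => path_eval g' s) @ G --> path_eval g s) ->
  G --> g.
Proof.
move=> H A [_ [[V oV <-] Vg] VA]; apply: (filterS VA).
suff : (@fmap Omega (all_paths t) set_val G) --> (set_val g : all_paths t).
  by apply; exact: open_nbhs_nbhs.
apply/cvg_sup => s B [_ [[V' oV' <-] V'g] V'B]; apply: (filterS V'B).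
by apply: (H s); exact: open_nbhs_nbhs.
Qed.

(** * Grids of times and nonnegative cylindrical functions *)

Lemma mk_path_subproof (h : R -> Rhat R) :
  (fun s : `[0%R, t]%classic => if set_val s == 0 then Some x
     else if set_val s == t then Some y else h (set_val s))
  \in fixed_endpoints t x y.
Proof.
apply/mem_set; split=> s /= ->; first by rewrite eqxx.
by rewrite gt_eqF // eqxx.
Qed.

Definition mk_path (h : R -> Rhat R) : Omega :=
  exist (fun g => g \in fixed_endpoints t x y) _ (mk_path_subproof h).

Lemma path_eval_mk h (s : `[0%R, t]%classic) : path_eval (mk_path h) s =
  if set_val s == 0 then Some x else if set_val s == t then Some y
  else h (set_val s).
Proof. by []. Qed.

Lemma path_eval0 (g : Omega) (s : `[0%R, t]%classic) :
  set_val s = 0 -> path_eval g s = Some x.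
Proof. by case: g => g /[dup] /set_mem[g0 _] ? /g0. Qed.

Lemma path_eval1 (g : Omega) (s : `[0%R, t]%classic) :
  set_val s = t -> path_eval g s = Some y.
Proof. by case: g => g /[dup] /set_mem[_ g1] ? /g1. Qed.

(** Times decrease, in the order in which [chain] consumes them; the empty grid is allowed and
    carries the constants. *)
Definition grid (ss : seq R) : bool := path >%R t (rcons ss 0).

(** Dependence on finitely many values is an invariance condition, not a factorisation through
    tuples, so passing to a larger grid is immediate. *)
Definition supports (ss : seq R) (F : Omega -> R) : Prop :=
  forall g g' : Omega, (forall s, set_val s \in ss ->
    path_eval g s = path_eval g' s) -> F g = F g'.

Definition nncyl : set (Omega -> R) :=
  [set F : Omega -> R | [/\ continuous F, forall g, 0 <= F g &
    exists2 ss, grid ss & supports ss F]].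

Lemma gridP ss : grid ss <->
  sorted >%R ss /\ (forall u, u \in ss -> 0 < u < t).
Proof.
rewrite /grid; have tr : transitive (>%R : rel R).
  by move=> a b c ba ac; exact: lt_trans ac ba.
split=> [ps|[so ss0]].
  have ps' : sorted >%R ss.
    by apply/(subseq_sorted tr _ (ps : sorted >%R (t :: rcons ss 0)));
       rewrite -cats1; apply: (subseq_trans (prefix_subseq ss [:: 0]));
       exact: subseq_cons.
  split=> // u us; have := order_path_min tr ps; rewrite all_rcons.
  move=> /andP[_ /allP/(_ u us) ut]; rewrite (ut : u < t) andbT.
  have : sorted >%R (rcons ss 0) by move: ps => /path_sorted.
  by rewrite (sorted_pairwise tr) pairwise_rcons => /andP[/allP/(_ u us)].
case: ss so ss0 => [|u ss] /= so ss0; first by rewrite t0.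
have [|_ ->] := andP (ss0 u _); first by rewrite mem_head.
rewrite rcons_path so /=; have /andP[] // := ss0 (last u ss) (mem_last _ _).
Qed.

Definition merge_grid (ss ss' : seq R) : seq R :=
  rev (sort <=%R (undup (ss ++ ss'))).

Lemma mem_merge_grid ss ss' u :
  (u \in merge_grid ss ss') = (u \in ss) || (u \in ss').
Proof. by rewrite mem_rev mem_sort mem_undup mem_cat. Qed.

Lemma grid_merge ss ss' : grid ss -> grid ss' -> grid (merge_grid ss ss').
Proof.
move=> /gridP[_ s0] /gridP[_ s0']; apply/gridP; split.
  by rewrite rev_sorted sort_lt_sorted undup_uniq.
by move=> u; rewrite mem_merge_grid => /orP[/s0|/s0'].
Qed.

Lemma supports_sub ss ss' F : supports ss F -> {subset ss <= ss'} ->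
  supports ss' F.
Proof. by move=> sF sub g g' gg'; apply: sF => s /sub /gg'. Qed.

Lemma nncyl_sep (U : set Omega) (g : Omega) : open U -> U g ->
  exists F, [/\ nncyl F, 0 < F g & forall g', ~ U g' -> F g' = 0].
Proof.
move=> oU Ug.
(* The sets containing the support of a bump at g form a filter, which converges
   to g because each of its coordinates does. *)
pose G : set_system Omega := [set A | exists F,
  [/\ nncyl F, 0 < F g & forall g', ~ A g' -> F g' = 0]].
have simple1 : nncyl (fun=> 1).
  split=> //; first exact: cst_continuous.
  by exists [::] => //; rewrite /grid /= t0.
have FG : Filter G.
  split.
  - by exists (fun=> 1); split=> // g' /(_ Logic.I).
  - move=> A B [F [[cF F0 [ss gs sF]] Fg FA]] [F' [[cF' F'0 [ss' gs' sF']] F'g F'B]].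
    exists (fun g => F g * F' g); split; last 2 first.
    + exact: mulr_gt0.
    + move=> g' nAB; have [Ag'|nA] := pselect (A g').
        by rewrite F'B ?mulr0 // => Bg'; exact: nAB.
      by rewrite FA ?mul0r.
    split; first by move=> g'; exact: (continuousM (cF g') (cF' g')).
      by move=> g'; rewrite mulr_ge0.
    exists (merge_grid ss ss'); first exact: grid_merge.
    move=> g1 g2 e; rewrite (sF g1 g2) ?(sF' g1 g2) // => s ins; apply: e;
      by rewrite mem_merge_grid ins ?orbT.
  - move=> A B AB [F [LF Fg FA]]; exists F; split=> // g' nB; apply: FA.
    by move=> /AB.
suff : G --> g by apply; exact: open_nbhs_nbhs.
apply: path_cvg => s A As /=.
have [s0|s0] := eqVneq (set_val s) 0.
  (* At an endpoint all paths take the same value, so no path leaves [A] and the constant 1 serves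
     as bump. *)
  exists (fun=> 1); split=> // g'; rewrite /= path_eval0 // => nA.
  by case: nA; move: (nbhs_singleton As); rewrite path_eval0.
have [st|st] := eqVneq (set_val s) t.
  exists (fun=> 1); split=> // g'; rewrite /= path_eval1 // => nA.
  by case: nA; move: (nbhs_singleton As); rewrite path_eval1.
have [f [cf f0 fg fA]] := opc_bump As.
exists (fun g => f (path_eval g s)); split => //; last by move=> g' /fA.
split => //.
  move=> g'; apply: (@continuous_comp Omega (Rhat R) R (fun g => path_eval g s) f).
    exact: path_eval_continuous.
  exact: cf.
exists [:: set_val s].
  have := set_mem (valP s); rewrite /= in_itv /= => /andP[s0' st'].
  by rewrite /grid /= andbT !lt_neqAle st s0' st' eq_sym s0.
by move=> g1 g2 e; rewrite e // mem_head.
Qed.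


(** The kernel integrals run over real values only, so [F] is needed just on paths that avoid
    infinity. *)
Definition on_path (F : Omega -> R) (h : R -> R) : R := F (mk_path (Some \o h)).

Lemma on_path_agree ss F : supports ss F ->
  forall h h', (forall u, u \in ss -> h u = h' u) -> on_path F h = on_path F h'.
Proof.
by move=> sF h h' hh'; apply: sF => s ins; rewrite !path_eval_mk /= hh'.
Qed.

Let floor_cvg (v : R) :
  ((Num.floor (n.+1%:R * v))%:~R / n.+1%:R : R) @[n --> \oo] --> v.
Proof.
apply/cvgrPdist_le => e e0; near=> n.
have n0 : 0 < n.+1%:R :> R by rewrite ltr0n.
have /andP[fl fu] := floor_itv (n.+1%:R * v).
set k := (Num.floor _)%:~R in fl fu *.
have ne : 1 <= e * n.+1%:R.
  rewrite -ler_pdivrMl // mulr1.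
  have : e^-1 <= n%:R by near: n; exact: nbhs_infty_ger.
  by move=> /le_trans; apply; rewrite ler_nat.
rewrite intrD -/k in fu.
have -> : v - k / n.+1%:R = (n.+1%:R * v - k) / n.+1%:R.
  by rewrite mulrBl mulrAC divff ?mul1r // gt_eqF.
rewrite normf_div (gtr0_norm n0) ler_pdivrMr // ger0_norm; lra.
Unshelve. all: by end_near. Qed.

(** No regularity of [psi] is required: there are countably many integer lists, and each is attained
    on a finite intersection of measurable sets. *)
Let measurable_countable d (X : measurableType d) (k : X -> R -> int) ss :
  (forall u (c : int), measurable [set a | k a u = c]) ->
  forall (psi : seq int -> R),
    measurable_fun setT (fun a => psi (map (k a) ss)).
Proof.
move=> mk psi _ B mB; rewrite setTI.
rewrite (_ : _ @^-1` B = \bigcup_(l : seq int)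
    [set a | map (k a) ss = l /\ B (psi l)]); last first.
  apply/seteqP; split=> a; first by exists (map (k a) ss).
  by case=> l _ /= [-> ].
apply: countable_bigcupT_measurable; first exact: countableP.
move=> l; have [Bl|nBl] := pselect (B (psi l)); last first.
  by rewrite (_ : [set _ | _] = set0) //; apply/seteqP; split=> a // [].
rewrite (_ : [set _ | _] = [set a | map (k a) ss = l]); last first.
  by apply/seteqP; split=> a //= [].
elim: ss l {psi Bl} => [|u ss IH] [|c l] /=.
- by rewrite (_ : [set _ | _] = setT) //; apply/seteqP; split.
- by rewrite (_ : [set _ | _] = set0) //; apply/seteqP; split.
- by rewrite (_ : [set _ | _] = set0) //; apply/seteqP; split.
- rewrite (_ : [set _ | _] = [set a | k a u = c] `&` [set a | map (k a) ss = l]).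
    by apply: measurableI.
  by apply/seteqP; split=> a /= [-> ->].
Qed.

(* Rounding h down to a multiple of 1/n.+1 leaves countably many values at the
   finitely many relevant times, and pointwise convergence of the paths is
   convergence in the product topology. *)
Lemma on_path_measurable ss F : continuous F -> supports ss F ->
  path_measurable (on_path F).
Proof.
move=> cF sF d X h mh.
pose k n a u : int := Num.floor (n.+1%:R * h a u).
pose hn n a u : R := (k n a u)%:~R / n.+1%:R.
apply: (@measurable_fun_cvg _ _ _ _ (fun n a => on_path F (hn n a))) => //.
- move=> n.
  pose psi (l : seq int) := on_path F (fun u => (nth 0 l (index u ss))%:~R / n.+1%:R).
  rewrite (_ : (fun a => _) = (fun a => psi (map (k n a) ss))); last first.
    apply/funext => a; apply: (on_path_agree sF) => u us.
    by rewrite (nth_map 0) ?index_mem // nth_index.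
  apply: measurable_countable => u c.
  rewrite (_ : [set _ | _] =
    (fun a => n.+1%:R * h a u) @^-1` `[c%:~R, (c + 1)%:~R[%classic).
    rewrite -[_ @^-1` _]setTI.
    have : measurable_fun setT (fun a => n.+1%:R * h a u).
      by apply: measurable_funM => //; exact: measurable_cst.
    by apply; [exact: measurableT|exact: measurable_itv].
  apply/seteqP; split=> a /=; rewrite in_itv /= -floor_eq.
    by move/eqP.
  by move/eqP.
- move=> a _; apply: (@continuous_cvg _ Omega R).
    exact: cF.
  apply: path_cvg => s.
  change ((fun n => path_eval (mk_path (Some \o hn n a)) s) @ \oo -->
    path_eval (mk_path (Some \o h a)) s).
  rewrite path_eval_mk.
  under eq_fun do rewrite path_eval_mk.
  case: ifP => _; first exact: cvg_cst.
  case: ifP => _; first exact: cvg_cst.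
  have dc : (fun n => hn n a (set_val s)) @ \oo --> h a (set_val s).
    exact: floor_cvg.
  have sc := @one_point_compactification_some_continuous R (h a (set_val s)).
  change ((Some : R -> Rhat R) \o (fun n => hn n a (set_val s)) @ \oo -->
    (Some (h a (set_val s)) : Rhat R)).
  apply: cvg_comp; first exact: dc.
  exact: sc.
Qed.

End PathSpace.

(** * The Wiener measure *)

Section Wiener.
Context {R : realType} (D t x y : R) (D0 : 0 < D) (t0 : 0 < t).
Local Notation Omega := (path_space t0 x y).
Local Notation chainF F ss := (chain D x (on_path F) ss t y (fun=> 0)).

(** Filtering [ss'] by membership in [ss] gives [ss] itself, as both are strictly decreasing with
    the same elements; [F] ignores the discarded times. *)
Lemma chain_grid_sub (F : Omega -> R) ss ss' : nncyl F ->
  grid t ss -> grid t ss' -> {subset ss <= ss'} -> supports ss F ->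
  chainF F ss' = chainF F ss.
Proof.
move=> [cF F0 _] gs gs' sub sF.
rewrite (@chain_filter R D x D0 (mem ss)) //; last 3 first.
- by move=> h; exact: F0.
- exact: on_path_measurable cF sF.
- exact: on_path_agree sF.
congr (chain _ _ _ _ _ _ _).
have tr : transitive (>%R : rel R) by move=> a b c ba ac; exact: lt_trans ac ba.
have [ss_sorted _] := (gridP t0 ss).1 gs; have [ss'_sorted _] := (gridP t0 ss').1 gs'.
apply: (irr_sorted_eq tr) => //; first by move=> u; exact: ltxx.
  exact: sorted_filter.
move=> u; rewrite mem_filter /=; case: (boolP (u \in ss)) => // /sub ->.
by [].
Qed.

(** An arbitrary supporting grid is chosen, with the empty grid as default when there is none. *)
Definition bridge_integral (F : Omega -> R) : R :=
  fine (chainF F (xget [::] [set ss | grid t ss /\ supports ss F])).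

(** The chosen grid and [ss] are both compared with their merger. Finiteness holds because [F] is
    bounded on the compact path space. *)
Lemma bridge_integralE (F : Omega -> R) ss : nncyl F ->
  grid t ss -> supports ss F -> (bridge_integral F)%:E = chainF F ss.
Proof.
move=> sF gs sup; rewrite /bridge_integral.
case: xgetP => [_ -> [gs' sup']|/(_ ss)]; last by case.
set ss' := xget _ _ in gs' sup' *.
have [cF F0 _] := sF.
have [M _ FM] := continuous_bounded_compact (@path_space_compact R t t0 x y) cF.
rewrite fineK; last first.
  apply: (@chain_fin R D x D0 _ _ _ _ _ M).
  - by move=> h; exact: F0.
  - exact: on_path_measurable cF sup'.
  - by move=> h; exact: le_trans (ler_norm _) (FM _).
  - exact: gs'.
rewrite -(chain_grid_sub sF gs' (grid_merge t0 gs gs')) //; last first.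
  by move=> u; rewrite mem_merge_grid orbC => ->.
rewrite -(chain_grid_sub sF gs (grid_merge t0 gs gs')) //.
by move=> u us; rewrite mem_merge_grid us.
Qed.

Lemma nncyl_add (F G : Omega -> R) : nncyl F -> nncyl G ->
  nncyl (fun g => F g + G g).
Proof.
move=> [cF F0 [ss gs sF]] [cG G0 [ss' gs' sG]]; split.
- by move=> g; exact: (continuousD (cF g) (cG g)).
- by move=> g; exact: addr_ge0.
- exists (merge_grid ss ss'); first exact: grid_merge.
  move=> g1 g2 e; congr (_ + _).
    by apply: sF => s us; apply: e; rewrite mem_merge_grid us.
  by apply: sG => s us; apply: e; rewrite mem_merge_grid us orbT.
Qed.

Lemma nncyl_scale (c : R) (F : Omega -> R) : 0 <= c -> nncyl F ->
  nncyl (fun g => c * F g).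
Proof.
move=> c0 [cF F0 [ss gs sF]]; split.
- by move=> g; apply: continuousM; [exact: cst_continuous|exact: cF].
- by move=> g; exact: mulr_ge0.
- by exists ss => // g1 g2 e; rewrite (sF g1 g2).
Qed.

Lemma nncyl_max (F : Omega -> R) ss : continuous F -> grid t ss ->
  supports ss F -> nncyl (fun g => Num.max (F g) 0).
Proof.
move=> cF gs sF; split.
- by move=> g; apply: continuous_max; [exact: cF|exact: cst_continuous].
- by move=> g; rewrite le_max lexx orbT.
- by exists ss => // g1 g2 e; rewrite (sF g1 g2).
Qed.

Lemma nncyl_tsub (F G : Omega -> R) : nncyl F -> nncyl G ->
  nncyl (tsub F G).
Proof.
move=> [cF F0 [ss gs sF]] [cG G0 [ss' gs' sG]].
apply: (@nncyl_max (fun g => F g - G g) (merge_grid ss ss')).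
- by move=> g; exact: (continuousB (cF g) (cG g)).
- exact: grid_merge.
- move=> g1 g2 e; congr (_ - _).
    by apply: sF => s us; apply: e; rewrite mem_merge_grid us.
  by apply: sG => s us; apply: e; rewrite mem_merge_grid us orbT.
Qed.

Lemma nncyl_one : nncyl ((fun=> 1) : Omega -> R).
Proof.
split=> //; first exact: cst_continuous.
by exists [::] => //; rewrite /grid /= t0.
Qed.

Lemma common_grid (F G : Omega -> R) : nncyl F -> nncyl G ->
  exists ss, [/\ grid t ss, supports ss F & supports ss G].
Proof.
move=> [_ _ [ss gs sF]] [_ _ [ss' gs' sG]]; exists (merge_grid ss ss'); split.
- exact: grid_merge.
- by apply: supports_sub sF _ => u us; rewrite mem_merge_grid us.
- by apply: supports_sub sG _ => u us; rewrite mem_merge_grid us orbT.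
Qed.

Lemma bridge_positive_functional :
  positive_functional (@nncyl R t t0 x y) bridge_integral.
Proof.
split.
- by move=> F [].
- by move=> F [].
- exact: nncyl_one.
- exact: nncyl_add.
- exact: nncyl_scale.
- exact: nncyl_tsub.
- by move=> U p; exact: nncyl_sep.
- move=> F G sF sG FG; have [ss [gs suF suG]] := common_grid sF sG.
  rewrite -lee_fin (bridge_integralE sF gs suF) (bridge_integralE sG gs suG).
  have [[cF F0 _] [cG G0 _]] := (sF, sG).
  apply: chain_le; [by move=> h; exact: F0|exact: on_path_measurable cF suF
    |exact: on_path_measurable cG suG|by move=> h; exact: FG].
- move=> F G sF sG; have [ss [gs suF suG]] := common_grid sF sG.
  apply: EFin_inj; rewrite EFinD (bridge_integralE sF gs suF).
  rewrite (bridge_integralE sG gs suG).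
  rewrite (bridge_integralE (nncyl_add sF sG) gs); last first.
    by move=> g1 g2 e; rewrite (suF g1 g2) // (suG g1 g2).
  have [[cF F0 _] [cG G0 _]] := (sF, sG).
  apply: chainD; [by move=> h; exact: F0|exact: on_path_measurable cF suF
    |by move=> h; exact: G0|exact: on_path_measurable cG suG].
- move=> c F c0 sF; have [_ _ [ss gs suF]] := sF.
  apply: EFin_inj; rewrite EFinM (bridge_integralE sF gs suF).
  rewrite (bridge_integralE (nncyl_scale c0 sF) gs); last first.
    by move=> g1 g2 e; rewrite (suF g1 g2).
  have [cF F0 _] := sF.
  by apply: chainZ => //; exact: on_path_measurable cF suF.
Qed.

(** The positive and negative parts of [F] lie in the cone and share the grid of [F];
    [iterated_chain] with [c = 1] reassembles them into one iterated integral. *)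
Lemma cylindrical_formula_of_functional
    (W : {measure set (borel Omega) -> \bar R}) :
  (forall F, nncyl F -> (\int[W]_g (F g)%:E = (bridge_integral F)%:E)%E) ->
  cylindrical_formula D W.
Proof.
move=> WI F [cF _] N ts Ft N0 pts FE.
pose tv : seq R := map set_val ts.
have gtv : grid t (rev tv) by rewrite /grid rev_path_lt.
have tv_in u : u \in tv -> 0 < u < t.
  by move=> utv; apply: ((gridP t0 (rev tv)).1 gtv).2; rewrite mem_rev.
have sF : supports (rev tv) F.
  move=> g1 g2 e; rewrite !FE; congr Ft; apply: eq_from_tnth => i.
  by rewrite !tnth_map; apply: e; rewrite mem_rev map_f // mem_tnth.
pose Fp g := Num.max (F g) 0; pose Fn g := Num.max (- F g) 0.
have sFn' : supports (rev tv) (fun g => - F g) by move=> g1 g2 /sF ->.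
have sp : nncyl Fp by exact: nncyl_max sF.
have sn : nncyl Fn.
  apply: (nncyl_max _ gtv sFn') => g; exact: (continuousN (cF g)).
have supp : supports (rev tv) Fp by move=> g1 g2 /sF; rewrite /Fp => ->.
have supn : supports (rev tv) Fn by move=> g1 g2 /sF; rewrite /Fn => ->.
have [M _ FM] := continuous_bounded_compact (@path_space_compact R t t0 x y) cF.
have M0 : 0 <= M by exact: le_trans (FM point).
rewrite integralE.
rewrite (_ : ((fun g => (F g)%:E)^\+)%E = (fun g => (Fp g)%:E)); last first.
  by apply/funext => g; rewrite funeposE EFin_max.
rewrite (_ : ((fun g => (F g)%:E)^\-)%E = (fun g => (Fn g)%:E)); last first.
  by apply/funext => g; rewrite funenegE EFin_max.
rewrite !WI // (bridge_integralE sp gtv supp) (bridge_integralE sn gtv supn).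
have := @iterated_chain _ D x D0 M 1 (on_path Fp) (on_path Fn) N tv t y (fun=> 0).
rewrite mul1e => <- //; last 7 first.
- by move=> h; have [_ + _] := sp; apply.
- by have [c _ _] := sp; exact: on_path_measurable supp.
- by move=> h; rewrite /on_path /Fp ge_max M0 andbT (le_trans (ler_norm _)).
- by move=> h; have [_ + _] := sn; apply.
- by have [c _ _] := sn; exact: on_path_measurable supn.
- by move=> h; rewrite /on_path /Fn ge_max M0 andbT (le_trans (ler_norm _)) // normrN.
- by rewrite size_map size_tuple.
congr (iterated_integral _); apply/funext => zs; rewrite mulr1; congr (_ * _)%:E.
transitivity (on_path F (upds (fun=> 0) tv zs)).
  by rewrite /on_path /Fp /Fn /Num.max; do !case: ifPn; lra.
(* The path built from [zs] takes the value of its [i]-th entry at the [i]-th time, as the times are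
   distinct and differ from 0 and [t]. *)
rewrite /on_path FE; congr Ft; apply: eq_from_tnth => i.
rewrite !tnth_map path_eval_mk.
have iN : (i < size tv)%N by rewrite size_map size_tuple.
have tvi : set_val (tnth ts i) = nth 0 tv i.
  by rewrite -tnth_nth -/(tnth (map_tuple set_val ts) i) ?tnth_map.
have /tv_in /andP[tv0 tvt] : set_val (tnth ts i) \in tv by rewrite map_f // mem_tnth.
rewrite gt_eqF // lt_eqF //= tvi upds_nth //.
- by rewrite (tnth_nth 0).
- apply: sorted_uniq (lt_trans) ltxx _ _.
  by have := path_sorted pts; rewrite -cats1 => /cat_sorted2[].
- by rewrite size_map !size_tuple.
Qed.


Lemma to_time_subproof (u : R) :
  Num.max 0 (Num.min u t) \in (`[0%R, t]%classic : set R).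
Proof.
by apply/mem_set; rewrite /= in_itv /= le_max lexx ge_max (ltW t0) ge_min lexx orbT.
Qed.

Definition to_time (u : R) : `[0%R, t]%classic :=
  exist (fun u => u \in (`[0%R, t]%classic : set R)) _ (to_time_subproof u).

Lemma to_timeK u : 0 < u < t -> set_val (to_time u) = u.
Proof.
move=> /andP[u0 ut]; rewrite -[LHS]/(Num.max 0 (Num.min u t)).
by rewrite min_l ?max_r // ltW.
Qed.

Lemma integral_nncyl_unique (W W' : {measure set (borel Omega) -> \bar R}) :
  cylindrical_formula D W -> cylindrical_formula D W' ->
  forall F : Omega -> R, nncyl F -> (\int[W]_g (F g)%:E = \int[W']_g (F g)%:E)%E.
Proof.
move=> fW fW' F [cF F0 [ss gs sF]].
(* The formula speaks of at least one interior time, while the grid of [F] may be empty; the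
   midpoint is therefore adjoined. *)
have ght : grid t [:: t / 2].
  by rewrite /grid /= divr_gt0 // ltr_pdivrMr // ltr_pMr // ltr1n.
pose ss' := merge_grid ss [:: t / 2].
have gs' : grid t ss' by exact: grid_merge.
pose tv := rev ss'.
have tv_in u : u \in tv -> 0 < u < t.
  by rewrite mem_rev; exact: ((gridP t0 ss').1 gs').2.
have sF' : supports ss' F.
  by apply: supports_sub sF _ => u us; rewrite mem_merge_grid us.
pose ts : (size tv).-tuple `[0%R, t]%classic := map_tuple to_time (in_tuple tv).
have tsE : map set_val ts = tv.
  by rewrite -map_comp -[RHS]map_id; apply/eq_in_map => u /tv_in /to_timeK.
have pts : path <%R 0 (rcons (map set_val ts) t).
  by rewrite tsE -rev_path_lt /tv revK.
(* A path is rebuilt from the tuple of its values; interior times off the grid receive [None], which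
   [F] does not see. *)
pose Ft (l : (size tv).-tuple (Rhat R)) : R :=
  F (mk_path t0 x y (fun u => nth None l (index u tv))).
have FE g : F g = Ft (map_tuple (path_eval g) ts).
  apply: sF' => s sin; rewrite path_eval_mk.
  have stv : set_val s \in tv by rewrite mem_rev.
  have /andP[s0 st] := tv_in _ stv.
  rewrite gt_eqF // lt_eqF // (nth_map (to_time 0)) ?size_map ?index_mem //.
  congr path_eval; apply: val_inj => /=.
  rewrite -[LHS]/(set_val s) -[RHS]/(set_val _).
  rewrite (nth_map 0) ?index_mem // nth_index // to_timeK // s0.
  by rewrite st.
have cyl : cylindrical F.
  split=> //; exists (size tv), ts, Ft; split=> //.
  have := path_sorted pts; rewrite -cats1 => /cat_sorted2[+ _].
  by apply: sub_sorted => a b; exact: ltW.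
have N0 : (0 < size tv)%N.
  rewrite -has_predT; apply/hasP; exists (t / 2) => //.
  by rewrite mem_rev mem_merge_grid mem_head orbT.
by rewrite (fW _ cyl _ _ _ N0 pts FE) (fW' _ cyl _ _ _ N0 pts FE).
Qed.

End Wiener.

Theorem theorem4p5 (R : realType) (D t x y : R) (D0 : 0 < D) (t0 : 0 < t) :
  exists W : {finite_measure set (borel (path_space t0 x y)) -> \bar R},
    [/\ regular_measure W, cylindrical_formula D W &
      forall W' : {finite_measure set (borel (path_space t0 x y)) -> \bar R},
        regular_measure W' -> cylindrical_formula D W' ->
        forall A : set (borel (path_space t0 x y)),
          measurable A -> W' A = W A].
Proof.
have cpt := @path_space_compact R t t0 x y.
have pf := bridge_positive_functional x y D0 t0.
have [W rW WI] := riesz_markov cpt pf.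
have fW : cylindrical_formula D W by exact: cylindrical_formula_of_functional WI.
exists W; split => // W' rW' fW' A mA.
apply: (regular_measure_unique cpt pf) => // F sF.
by rewrite (integral_nncyl_unique fW' fW sF).
Qed.
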